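(* Let $\mathfrak A,\mathfrak B,\mathfrak C$ be bicategories and $\mathbf F:\mathfrak A\to\mathfrak B$, $\mathbf G:\mathfrak B\to\mathfrak C$, $\mathbf H:\mathfrak A\to\mathfrak C$ pseudofunctors with a pseudonatural equivalence $\Gamma:\mathbf{GF}\Rightarrow\mathbf H$. Suppose $\mathbf F$ has a left biadjoint $\mathbf L:\mathfrak B\to\mathfrak A$ and $\mathbf H$ has a left biadjoint $\mathbf N:\mathfrak C\to\mathfrak A$, the unit of $\mathbf N\dashv\mathbf H$ being $\Psi:\mathbf 1_{\mathfrak C}\Rightarrow\mathbf{HN}$. Assume that $\mathbf G$ is fully faithful and that: 1. there is a modification $\mu':\Psi_{\mathbf{HN}}\Rrightarrow(\mathbf{HN})\Psi$ (between pseudonatural transformations $\mathbf{HN}\Rightarrow(\mathbf{HN})(\mathbf{HN})$) such that, for any object $C$ of $\mathfrak C$, $\mu'_C$ has an inverter $(M'(C),\ \Lambda'_C:M'(C)\to\mathbf{HN}(C))$ in $\mathfrak C$; 2. $\mu'*\Psi$ is invertible; 3. an object $C$ of $\mathfrak C$ is in the essential image of $\mathbf G$ if and only if $(C,\Psi_C)$ is an inverter of $\mu'_C$; 4. $\mathbf{HN}$ preserves the pseudomonicity of $\Lambda'_C$ for any object $C$ of $\mathfrak C$ (i.e. $\mathbf{HN}(\Lambda'_C)$ is pseudomonic). Then, for any object $C$ of $\mathfrak C$, $M'(C)$ is in the essential image of $\mathbf G$. Choosing for any $C$ an object $M(C)$ of $\mathfrak B$ such that $\mathbf G(M(C))$ is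 equivalent to $M'(C)$, one gets a pseudofunctor $\mathbf M:\mathfrak C\to\mathfrak B$ (given on objects by $C\mapsto M(C)$) which is a left biadjoint of $\mathbf G$.
   Context: **Conventions.** Bicategories and pseudofunctors are in the general weak sense; $\circ$ is composition of 1-morphisms and vertical composition of 2-morphisms; $*$ is horizontal composition, a 1-morphism in a $*$-expression standing for its identity 2-morphism. Pseudonatural transformations are written $\Rightarrow$ and modifications $\Rrightarrow$. Whiskering: $\Psi_{\mathbf{HN}}$ has components $\Psi_{\mathbf{HN}(C)}$ and $(\mathbf{HN})\Psi$ has components $\mathbf{HN}(\Psi_C)$ (unitors for composition with identity pseudofunctors being suppressed). **Biadjunction** $\mathbf L\dashv\mathbf R$ ($\mathbf L:\mathfrak A\to\mathfrak B$, $\mathbf R:\mathfrak B\to\mathfrak A$): pseudonatural transformations $\mathrm H:\mathbf 1_{\mathfrak A}\Rightarrow\mathbf{RL}$ (unit), $\mathrm E:\mathbf{LR}\Rightarrow\mathbf 1_{\mathfrak B}$ (counit) and invertible modifications $\mathrm E_{\mathbf L}\circ\mathbf L(\mathrm H)\Rrightarrow1_{\mathbf L}$ and $\mathbf R(\mathrm E)\circ\mathrm H_{\mathbf R}\Rrightarrow1_{\mathbf R}$ (associators of pseudofunctor composition inserted where needed); no further coherence is required. Then $\mathbf L$ is a left biadjoint of $\mathbf R$. **Inverters.** For a 2-morphism $\phi:f_1\Rightarrow f_2$ between $f_1,f_2:X_1\to X_2$ in a bicategory $\mathfrak D$, an inverter cone is a pair $(X_0,f_0:X_0\to X_1)$ with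 $\phi*f_0$ invertible; for fixed $X_0$ these form a full subcategory $\mathbf{InvCone}(X_0;\phi)\subseteq\mathbf{Hom}_{\mathfrak D}(X_0,X_1)$. An inverter of $\phi$ is an inverter cone $(\tilde X_0,\tilde f_0)$ such that for every $X_0$, $\tilde f_0\circ-$ induces an equivalence $\mathbf{Hom}_{\mathfrak D}(X_0,\tilde X_0)\to\mathbf{InvCone}(X_0;\phi)$. A 1-morphism $f:X\to Y$ is pseudomonic if for every object $W$ the functor $f\circ-:\mathbf{Hom}(W,X)\to\mathbf{Hom}(W,Y)$ is pseudomonic (faithful, and full on isomorphisms). A pseudofunctor $\mathbf G$ is fully faithful if all its local functors $\mathbf{Hom}(X,Y)\to\mathbf{Hom}(\mathbf GX,\mathbf GY)$ are equivalences of categories. An object is in the essential image of $\mathbf G$ if it is equivalent to some $\mathbf G(B)$. *)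

(* Defs.v *)
Set Implicit Arguments.
Unset Strict Implicit.
Unset Printing Implicit Defensive.

Declare Scope bicat_scope.
Delimit Scope bicat_scope with bicat.
Open Scope bicat_scope.

Reserved Notation "b • a" (at level 40, left associativity).
Reserved Notation "g ∘ f" (at level 36, left associativity).
Reserved Notation "b ⋆ a" (at level 38, left associativity).
Reserved Notation "F ·₁ f" (at level 30, no associativity).
Reserved Notation "F ·₂ a" (at level 30, no associativity).
Reserved Notation "i ^-1" (at level 1, left associativity, format "i ^-1").

Record Category := {
  obj :> Type;
  mor : obj -> obj -> Type;
  idm : forall x, mor x x;
  cmp : forall x y z, mor y z -> mor x y -> mor x z;
  cmp_idl : forall x y (a : mor x y), cmp (idm y) a = a;
  cmp_idr : forall x y (a : mor x y), cmp a (idm x) = a;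
  cmp_assoc : forall w x y z (c : mor y z) (b : mor x y) (a : mor w x),
    cmp (cmp c b) a = cmp c (cmp b a)
}.
Arguments mor {_} _ _.
Arguments idm {_} _.
Arguments cmp {_ _ _ _} _ _.

Notation "b • a" := (cmp b a) : bicat_scope.

Record Iso (C : Category) (x y : C) := {
  fwd :> mor x y;
  bwd : mor y x;
  bwd_fwd : bwd • fwd = idm x;
  fwd_bwd : fwd • bwd = idm y
}.
Arguments fwd {_ _ _} _.
Arguments bwd {_ _ _} _.

Definition invertible (C : Category) (x y : C) (a : mor x y) : Prop :=
  exists b : mor y x, b • a = idm x /\ a • b = idm y.

Record Functor (C D : Category) := {
  fob :> C -> D;
  fmor : forall x y, mor x y -> mor (fob x) (fob y);
  fmor_id : forall x, fmor (idm x) = idm (fob x);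
  fmor_cmp : forall x y z (b : mor y z) (a : mor x y), fmor (b • a) = fmor b • fmor a
}.
Arguments fmor {_ _} _ {_ _} _.

Definition functor_id (C : Category) : Functor C C.
Proof.
  refine {| fob := fun x => x; fmor := fun _ _ a => a |}; reflexivity.
Defined.

Definition functor_comp (C D E : Category) (G : Functor D E) (F : Functor C D) : Functor C E.
Proof.
  refine {| fob := fun x => G (F x); fmor := fun _ _ a => fmor G (fmor F a) |}.
  - intros; now rewrite !fmor_id.
  - intros; now rewrite !fmor_cmp.
Defined.

Record NatIso (C D : Category) (F G : Functor C D) := {
  nat_iso :> forall x, Iso (F x) (G x);
  nat_iso_nat : forall x y (a : mor x y), nat_iso y • fmor F a = fmor G a • nat_iso x
}.

Definition is_equivalence_of_categories (C D : Category) (F : Functor C D) : Prop :=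
  exists G : Functor D C,
    inhabited (NatIso (functor_comp G F) (functor_id C)) /\
    inhabited (NatIso (functor_comp F G) (functor_id D)).

Definition faithful (C D : Category) (F : Functor C D) : Prop :=
  forall x y (a b : mor x y), fmor F a = fmor F b -> a = b.

Definition full_on_isos (C D : Category) (F : Functor C D) : Prop :=
  forall x y (i : Iso (F x) (F y)), exists j : Iso x y, fmor F j = i.

Definition pseudomonic_functor (C D : Category) (F : Functor C D) : Prop :=
  faithful F /\ full_on_isos F.

Definition full_subcategory (C : Category) (P : C -> Prop) : Category.
Proof.
  refine {| obj := {x : C | P x};
            mor := fun x y => mor (proj1_sig x) (proj1_sig y);
            idm := fun x => idm (proj1_sig x);
            cmp := fun _ _ _ b a => b • a |}.
  - intros; apply cmp_idl.
  - intros; apply cmp_idr.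
  - intros; apply cmp_assoc.
Defined.

Section Calculus.
Variable C : Category.
Implicit Types x y z : C.

Lemma cmp_pre x y z (b : mor y z) (a : mor x y) c : b • a = c ->
  forall w (r : mor w x), b • (a • r) = c • r.
Proof. now intros <- w r; rewrite cmp_assoc. Qed.

Lemma iso_epi x y z (i : Iso x y) (a b : mor y z) : a • i = b • i -> a = b.
Proof.
  intros H; rewrite <- (cmp_idr a), <- (cmp_idr b), <- (fwd_bwd i).
  now rewrite <- !cmp_assoc, H.
Qed.

Lemma iso_mono x y z (i : Iso y z) (a b : mor x y) : i • a = i • b -> a = b.
Proof.
  intros H; rewrite <- (cmp_idl a), <- (cmp_idl b), <- (bwd_fwd i).
  now rewrite !cmp_assoc, H.
Qed.

Lemma fwd_to_bwd x y z (i : Iso y z) (a : mor x y) (b : mor x z) :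
  i • a = b -> a = bwd i • b.
Proof. now intros <-; rewrite <- cmp_assoc, bwd_fwd, cmp_idl. Qed.

Lemma bwd_fwd_pre x y (i : Iso x y) w (r : mor w x) : bwd i • (fwd i • r) = r.
Proof. now rewrite <- cmp_assoc, bwd_fwd, cmp_idl. Qed.

Lemma fwd_bwd_pre x y (i : Iso x y) w (r : mor w y) : fwd i • (bwd i • r) = r.
Proof. now rewrite <- cmp_assoc, fwd_bwd, cmp_idl. Qed.

Lemma iso_conj x y x' y' (i : Iso x y) (i' : Iso x' y') (a : mor x x') (b : mor y y') :
  i' • a = b • i -> a • bwd i = bwd i' • b.
Proof.
  intros H; apply (iso_mono (i := i')), (iso_epi (i := i)).
  now rewrite fwd_bwd_pre, !cmp_assoc, bwd_fwd, cmp_idr.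
Qed.

Definition iso_id x : Iso x x :=
  Build_Iso (cmp_idl (idm x)) (cmp_idl (idm x)).

Definition iso_inv x y (i : Iso x y) : Iso y x :=
  Build_Iso (fwd_bwd i) (bwd_fwd i).

Definition iso_cmp x y z (j : Iso y z) (i : Iso x y) : Iso x z.
Proof.
  refine {| fwd := j • i; bwd := bwd i • bwd j |}.
  - now rewrite cmp_assoc, bwd_fwd_pre, bwd_fwd.
  - now rewrite cmp_assoc, fwd_bwd_pre, fwd_bwd.
Defined.

Lemma iso_invertible x y (i : Iso x y) : invertible (fwd i).
Proof. exists (bwd i); split; [apply bwd_fwd | apply fwd_bwd]. Qed.

Lemma invertible_cmp x y z (b : mor y z) (a : mor x y) :
  invertible b -> invertible a -> invertible (b • a).
Proof.
  intros [b' [Hb Hb']] [a' [Ha Ha']]; exists (a' • b'); split.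
  - now rewrite cmp_assoc, (cmp_pre Hb), cmp_idl.
  - now rewrite cmp_assoc, (cmp_pre Ha'), cmp_idl.
Qed.
End Calculus.

Notation "i ^-1" := (iso_inv i) : bicat_scope.

Definition functor_iso (C D : Category) (F : Functor C D) (x y : C) (i : Iso x y) :
  Iso (F x) (F y).
Proof.
  refine {| fwd := fmor F i; bwd := fmor F (bwd i) |}.
  - now rewrite <- fmor_cmp, bwd_fwd, fmor_id.
  - now rewrite <- fmor_cmp, fwd_bwd, fmor_id.
Defined.

Record Bicategory := {
  bob :> Type;
  hom : bob -> bob -> Category;
  id1 : forall X, hom X X;
  comp1 : forall X Y Z, hom Y Z -> hom X Y -> hom X Z;
  hcomp : forall X Y Z (g g' : hom Y Z) (f f' : hom X Y),
    mor g g' -> mor f f' -> mor (comp1 g f) (comp1 g' f');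
  hcomp_id : forall X Y Z (g : hom Y Z) (f : hom X Y),
    hcomp (idm g) (idm f) = idm (comp1 g f);
  hcomp_cmp : forall X Y Z (g g' g'' : hom Y Z) (f f' f'' : hom X Y)
    (b' : mor g' g'') (b : mor g g') (a' : mor f' f'') (a : mor f f'),
    hcomp (b' • b) (a' • a) = hcomp b' a' • hcomp b a;
  lunit : forall X Y (f : hom X Y), Iso (comp1 (id1 Y) f) f;
  runit : forall X Y (f : hom X Y), Iso (comp1 f (id1 X)) f;
  assoc : forall W X Y Z (h : hom Y Z) (g : hom X Y) (f : hom W X),
    Iso (comp1 (comp1 h g) f) (comp1 h (comp1 g f));
  lunit_nat : forall X Y (f f' : hom X Y) (a : mor f f'),
    lunit f' • hcomp (idm (id1 Y)) a = a • lunit f;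
  runit_nat : forall X Y (f f' : hom X Y) (a : mor f f'),
    runit f' • hcomp a (idm (id1 X)) = a • runit f;
  assoc_nat : forall W X Y Z (h h' : hom Y Z) (g g' : hom X Y) (f f' : hom W X)
    (c : mor h h') (b : mor g g') (a : mor f f'),
    assoc h' g' f' • hcomp (hcomp c b) a = hcomp c (hcomp b a) • assoc h g f;
  triangle : forall X Y Z (g : hom Y Z) (f : hom X Y),
    hcomp (idm g) (lunit f) • assoc g (id1 Y) f = hcomp (runit g) (idm f);
  pentagon : forall V W X Y Z (k : hom Y Z) (h : hom X Y) (g : hom W X) (f : hom V W),
    assoc k h (comp1 g f) • assoc (comp1 k h) g f =
    hcomp (idm k) (assoc h g f) • (assoc k (comp1 h g) f • hcomp (assoc k h g) (idm f))
}.
Arguments hom {_} _ _.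
Arguments id1 {_} _.
Arguments comp1 {_ _ _ _} _ _.
Arguments hcomp {_ _ _ _ _ _ _ _} _ _.
Arguments lunit {_ _ _} _.
Arguments runit {_ _ _} _.
Arguments assoc {_ _ _ _ _} _ _ _.

Notation "g ∘ f" := (comp1 g f) : bicat_scope.
Notation "b ⋆ a" := (hcomp b a) : bicat_scope.

Section BicatCalculus.
Variable B : Bicategory.
Implicit Types V W X Y Z : B.

Lemma hcomp_cmp_l X Y Z (g : hom Y Z) (f f' f'' : hom X Y) (a' : mor f' f'') (a : mor f f') :
  idm g ⋆ (a' • a) = (idm g ⋆ a') • (idm g ⋆ a).
Proof. now rewrite <- hcomp_cmp, cmp_idl. Qed.

Lemma hcomp_cmp_r X Y Z (g g' g'' : hom Y Z) (f : hom X Y) (a' : mor g' g'') (a : mor g g') :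
  (a' • a) ⋆ idm f = (a' ⋆ idm f) • (a ⋆ idm f).
Proof. now rewrite <- hcomp_cmp, cmp_idl. Qed.

Lemma hcomp_lr X Y Z (g g' : hom Y Z) (f f' : hom X Y) (b : mor g g') (a : mor f f') :
  (b ⋆ idm f') • (idm g ⋆ a) = (idm g' ⋆ a) • (b ⋆ idm f).
Proof. now rewrite <- !hcomp_cmp, !cmp_idl, !cmp_idr. Qed.

Definition hcomp_iso X Y Z (g g' : hom Y Z) (f f' : hom X Y) (j : Iso g g') (i : Iso f f') :
  Iso (g ∘ f) (g' ∘ f').
Proof.
  refine {| fwd := fwd j ⋆ fwd i; bwd := bwd j ⋆ bwd i |}.
  - now rewrite <- hcomp_cmp, !bwd_fwd, hcomp_id.
  - now rewrite <- hcomp_cmp, !fwd_bwd, hcomp_id.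
Defined.

Definition lwhisker_iso X Y Z (g : hom Y Z) (f f' : hom X Y) (i : Iso f f') :
  Iso (g ∘ f) (g ∘ f') := hcomp_iso (iso_id g) i.

Definition rwhisker_iso X Y Z (g g' : hom Y Z) (j : Iso g g') (f : hom X Y) :
  Iso (g ∘ f) (g' ∘ f) := hcomp_iso j (iso_id f).

Lemma id1_lwhisker_inj X Y (f f' : hom X Y) (a b : mor f f') :
  idm (id1 Y) ⋆ a = idm (id1 Y) ⋆ b -> a = b.
Proof.
  intros H; apply (iso_epi (i := lunit f)); now rewrite <- !lunit_nat, H.
Qed.

Lemma id1_rwhisker_inj X Y (f f' : hom X Y) (a b : mor f f') :
  a ⋆ idm (id1 X) = b ⋆ idm (id1 X) -> a = b.
Proof.
  intros H; apply (iso_epi (i := runit f)); now rewrite <- !runit_nat, H.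
Qed.

Lemma lunit_comp X Y Z (g : hom Y Z) (f : hom X Y) :
  lunit (g ∘ f) • assoc (id1 Z) g f = lunit g ⋆ idm f.
Proof.
  apply id1_lwhisker_inj.
  apply (iso_epi (i := iso_cmp (assoc (id1 Z) (id1 Z ∘ g) f)
                               (rwhisker_iso (assoc (id1 Z) (id1 Z) g) f))); cbn.
  rewrite hcomp_cmp_l, cmp_assoc, <- pentagon, (cmp_pre (triangle _ _)).
  rewrite <- (hcomp_id g f), <- assoc_nat, <- triangle.
  rewrite hcomp_cmp_r, <- cmp_assoc, assoc_nat; now rewrite cmp_assoc.
Qed.

Lemma runit_comp X Y Z (g : hom Y Z) (f : hom X Y) :
  (idm g ⋆ runit f) • assoc g f (id1 X) = runit (g ∘ f).
Proof.
  apply id1_rwhisker_inj.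
  apply (iso_mono (i := assoc g f (id1 X))).
  rewrite hcomp_cmp_r, (cmp_pre (assoc_nat _ _ _)), <- (triangle f), hcomp_cmp_l, !cmp_assoc.
  rewrite <- pentagon, <- triangle, <- (hcomp_id g f).
  now rewrite <- cmp_assoc, <- assoc_nat, cmp_assoc.
Qed.

Lemma lunit_id1 X : fwd (lunit (id1 X)) = fwd (runit (id1 X)).
Proof.
  apply id1_rwhisker_inj; rewrite <- triangle, <- lunit_comp.
  f_equal; symmetry; apply (iso_mono (i := lunit (id1 X))); apply lunit_nat.
Qed.

Lemma assoc_inv_nat W X Y Z (h h' : hom Y Z) (g g' : hom X Y) (f f' : hom W X)
  (c : mor h h') (b : mor g g') (a : mor f f') :
  bwd (assoc h' g' f') • (c ⋆ (b ⋆ a)) = ((c ⋆ b) ⋆ a) • bwd (assoc h g f).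
Proof. symmetry; apply iso_conj, assoc_nat. Qed.
End BicatCalculus.

Definition is_equivalence (B : Bicategory) (X Y : B) (f : hom X Y) : Prop :=
  exists g : hom Y X,
    inhabited (Iso (g ∘ f) (id1 X)) /\ inhabited (Iso (f ∘ g) (id1 Y)).

Definition equivalent (B : Bicategory) (X Y : B) : Prop :=
  exists f : hom X Y, is_equivalence f.

Definition postcomp (B : Bicategory) (W X Y : B) (f : hom X Y) : Functor (hom W X) (hom W Y).
Proof.
  refine {| fob := fun k : hom W X => f ∘ k; fmor := fun _ _ a => idm f ⋆ a |}.
  - intros; apply hcomp_id.
  - intros; apply hcomp_cmp_l.
Defined.

Definition pseudomonic (B : Bicategory) (X Y : B) (f : hom X Y) : Prop :=
  forall W : B, pseudomonic_functor (postcomp W f).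

Section Inverters.
Variables (D : Bicategory) (X1 X2 : D) (f1 f2 : hom X1 X2) (phi : mor f1 f2).

Definition is_inverter_cone (X0 : D) (f0 : hom X0 X1) : Prop :=
  invertible (phi ⋆ idm f0).

Definition InvCone (X0 : D) : Category :=
  full_subcategory (C := hom X0 X1) (@is_inverter_cone X0).

Lemma inverter_cone_comp (X0 W : D) (f0 : hom X0 X1) (k : hom W X0) :
  is_inverter_cone f0 -> is_inverter_cone (f0 ∘ k).
Proof.
  intros [b [H1 H2]]; unfold is_inverter_cone.
  assert (E : phi ⋆ idm (f0 ∘ k) =
              assoc f2 f0 k • (((phi ⋆ idm f0) ⋆ idm k) • bwd (assoc f1 f0 k))).
  { rewrite <- hcomp_id, <- assoc_inv_nat; now rewrite fwd_bwd_pre. }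
  rewrite E; apply invertible_cmp; [apply iso_invertible | apply invertible_cmp].
  - exists (b ⋆ idm k); rewrite <- !hcomp_cmp_r, H1, H2; split; apply hcomp_id.
  - exact (iso_invertible ((assoc f1 f0 k)^-1)).
Qed.

Definition inverter_functor (Xt : D) (ft : hom Xt X1) (cone : is_inverter_cone ft) (X0 : D) :
  Functor (hom X0 Xt) (InvCone X0).
Proof.
  refine (@Build_Functor (hom X0 Xt) (InvCone X0)
    (fun k => exist _ (ft ∘ k) (inverter_cone_comp k cone)) (fun _ _ a => idm ft ⋆ a) _ _).
  - intros; apply hcomp_id.
  - intros; apply hcomp_cmp_l.
Defined.

Definition is_inverter (Xt : D) (ft : hom Xt X1) : Prop :=
  exists cone : is_inverter_cone ft,
    forall X0 : D, is_equivalence_of_categories (inverter_functor cone X0).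
End Inverters.

Record Pseudofunctor (A B : Bicategory) := {
  pob :> A -> B;
  ploc : forall X Y : A, Functor (hom X Y) (hom (pob X) (pob Y));
  pcomp : forall (X Y Z : A) (g : hom Y Z) (f : hom X Y),
    Iso (ploc Y Z g ∘ ploc X Y f) (ploc X Z (g ∘ f));
  pid : forall X : A, Iso (id1 (pob X)) (ploc X X (id1 X));
  pcomp_nat : forall (X Y Z : A) (g g' : hom Y Z) (f f' : hom X Y)
    (b : mor g g') (a : mor f f'),
    fmor (ploc X Z) (b ⋆ a) • pcomp g f =
    pcomp g' f' • (fmor (ploc Y Z) b ⋆ fmor (ploc X Y) a);
  pcomp_assoc : forall (W X Y Z : A) (h : hom Y Z) (g : hom X Y) (f : hom W X),
    fmor (ploc W Z) (assoc h g f) • (pcomp (h ∘ g) f • (pcomp h g ⋆ idm (ploc W X f))) =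
    pcomp h (g ∘ f) • ((idm (ploc Y Z h) ⋆ pcomp g f) • assoc _ _ _);
  pid_l : forall (X Y : A) (f : hom X Y),
    fmor (ploc X Y) (lunit f) • (pcomp (id1 Y) f • (pid Y ⋆ idm (ploc X Y f))) =
    lunit (ploc X Y f);
  pid_r : forall (X Y : A) (f : hom X Y),
    fmor (ploc X Y) (runit f) • (pcomp f (id1 X) • (idm (ploc X Y f) ⋆ pid X)) =
    runit (ploc X Y f)
}.
Arguments ploc {_ _} _ _ _.
Arguments pcomp {_ _} _ {_ _ _} _ _.
Arguments pid {_ _} _ _.

Notation "F ·₁ f" := (fob (ploc F _ _) f) : bicat_scope.
Notation "F ·₂ a" := (fmor (ploc F _ _) a) : bicat_scope.

Definition pseudofunctor_id (A : Bicategory) : Pseudofunctor A A.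
Proof.
  refine (@Build_Pseudofunctor A A (fun X => X) (fun X Y => functor_id (hom X Y))
    (fun _ _ _ g f => iso_id (g ∘ f)) (fun X => iso_id (id1 X)) _ _ _ _); intros; cbn.
  - now rewrite cmp_idl, cmp_idr.
  - now rewrite !hcomp_id, !cmp_idl, !cmp_idr.
  - now rewrite hcomp_id, !cmp_idr.
  - now rewrite hcomp_id, !cmp_idr.
Defined.

Definition pseudofunctor_comp (A B C : Bicategory)
  (G : Pseudofunctor B C) (F : Pseudofunctor A B) : Pseudofunctor A C.
Proof.
  refine (@Build_Pseudofunctor A C (fun X => G (F X))
    (fun X Y => functor_comp (ploc G (F X) (F Y)) (ploc F X Y))
    (fun _ _ _ g f => iso_cmp (functor_iso (ploc G _ _) (pcomp F g f)) (pcomp G (F ·₁ g) (F ·₁ f)))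
    (fun X => iso_cmp (functor_iso (ploc G _ _) (pid F X)) (pid G (F X))) _ _ _ _);
  intros; cbn.
  - rewrite <- cmp_assoc, <- fmor_cmp, pcomp_nat, fmor_cmp, !cmp_assoc.
    now rewrite pcomp_nat.
  - rewrite hcomp_cmp_r, hcomp_cmp_l.
    rewrite <- (fmor_id (ploc G _ _)).
    rewrite (cmp_assoc _ (fwd (pcomp G _ _))), <- (cmp_assoc (fwd (pcomp G (F ·₁ (h ∘ g)) (F ·₁ f)))).
    rewrite <- pcomp_nat, !cmp_assoc, fmor_id.
    rewrite <- (fmor_id (ploc G _ _) (F ·₁ h)).
    rewrite <- (cmp_assoc (fwd (pcomp G (F ·₁ h) (F ·₁ (g ∘ f))))).
    rewrite <- pcomp_nat, fmor_id, !cmp_assoc.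
    rewrite <- pcomp_assoc, <- !cmp_assoc, <- !fmor_cmp, !cmp_assoc.
    now rewrite pcomp_assoc.
  - rewrite hcomp_cmp_r, <- (fmor_id (ploc G _ _)), cmp_assoc.
    rewrite <- (cmp_assoc (fwd (pcomp G _ _))), <- pcomp_nat, fmor_id, !cmp_assoc.
    now rewrite <- !cmp_assoc, <- !fmor_cmp, !cmp_assoc, pid_l, pid_l.
  - rewrite hcomp_cmp_l, <- (fmor_id (ploc G _ _)), cmp_assoc.
    rewrite <- (cmp_assoc (fwd (pcomp G _ _))), <- pcomp_nat, fmor_id, !cmp_assoc.
    now rewrite <- !cmp_assoc, <- !fmor_cmp, !cmp_assoc, pid_r, pid_r.
Defined.

Definition fully_faithful (B C : Bicategory) (G : Pseudofunctor B C) : Prop :=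
  forall X Y : B, is_equivalence_of_categories (ploc G X Y).

Definition in_essential_image (B C : Bicategory) (G : Pseudofunctor B C) (Y : C) : Prop :=
  exists X : B, equivalent Y (G X).

Record Transformation (A B : Bicategory) (F G : Pseudofunctor A B) := {
  tob :> forall X : A, hom (F X) (G X);
  tnat : forall (X Y : A) (f : hom X Y), Iso (G ·₁ f ∘ tob X) (tob Y ∘ F ·₁ f);
  tnat_nat : forall (X Y : A) (f f' : hom X Y) (a : mor f f'),
    tnat f' • (G ·₂ a ⋆ idm (tob X)) = (idm (tob Y) ⋆ F ·₂ a) • tnat f;
  tnat_id : forall X : A,
    tnat (id1 X) • (pid G X ⋆ idm (tob X)) =
    (idm (tob X) ⋆ pid F X) • (bwd (runit (tob X)) • lunit (tob X));
  tnat_comp : forall (X Y Z : A) (g : hom Y Z) (f : hom X Y),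
    tnat (g ∘ f) • (pcomp G g f ⋆ idm (tob X)) =
    (idm (tob Z) ⋆ pcomp F g f) •
      (assoc _ _ _ • ((tnat g ⋆ idm (F ·₁ f)) •
        (bwd (assoc _ _ _) • ((idm (G ·₁ g) ⋆ tnat f) • assoc _ _ _))))
}.
Arguments tnat {_ _ _ _} _ {_ _} _.

Definition transformation_id (A B : Bicategory) (F : Pseudofunctor A B) : Transformation F F.
Proof.
  refine (@Build_Transformation A B F F (fun X => id1 (F X))
    (fun X Y f => iso_cmp ((lunit (F ·₁ f))^-1) (runit (F ·₁ f))) _ _ _); intros; cbn.
  - rewrite cmp_assoc, runit_nat, <- !cmp_assoc; f_equal.
    symmetry; exact (iso_conj (lunit_nat (F ·₂ a))).
  - rewrite cmp_assoc, runit_nat, <- !cmp_assoc.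

    rewrite lunit_id1, (cmp_assoc (_ ⋆ _)), bwd_fwd, cmp_idr, <- (iso_conj (lunit_nat (pid F X))), cmp_assoc.
    now rewrite <- lunit_id1, bwd_fwd, cmp_idr.
  - rewrite cmp_assoc, runit_nat, <- cmp_assoc.
    rewrite <- (iso_conj (lunit_nat (pcomp F g f))), cmp_assoc; f_equal.
    rewrite hcomp_cmp_l, hcomp_cmp_r, !cmp_assoc, runit_comp.
    symmetry; apply (iso_mono (i := lunit (F ·₁ g ∘ F ·₁ f))); rewrite fwd_bwd_pre.
    rewrite <- (cmp_assoc (fwd (lunit _))), lunit_comp, <- (cmp_assoc (_ ⋆ _) (_ ⋆ _)).
    rewrite <- hcomp_cmp_r, fwd_bwd, hcomp_id, cmp_idl, <- triangle, !cmp_assoc.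
    rewrite fwd_bwd_pre, <- (cmp_assoc (_ ⋆ _) (_ ⋆ _)), <- hcomp_cmp_l, fwd_bwd.
    now rewrite hcomp_id, cmp_idl.
Defined.

Section Pentagons.
Variables (B : Bicategory) (V W X Y Z : B).
Variables (k : hom Y Z) (h : hom X Y) (g : hom W X) (f : hom V W).

Lemma pentagon_1 :
  (idm k ⋆ assoc h g f) • assoc k (h ∘ g) f =
  assoc k h (g ∘ f) • (assoc (k ∘ h) g f • (bwd (assoc k h g) ⋆ idm f)).
Proof.
  rewrite <- cmp_assoc, pentagon, !cmp_assoc, <- hcomp_cmp_r, fwd_bwd, hcomp_id.
  now rewrite cmp_idr.
Qed.

Lemma pentagon_2 :
  (idm k ⋆ bwd (assoc h g f)) • assoc k h (g ∘ f) =
  assoc k (h ∘ g) f • ((assoc k h g ⋆ idm f) • bwd (assoc (k ∘ h) g f)).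
Proof.
  apply (iso_epi (i := assoc (k ∘ h) g f)).
  rewrite !cmp_assoc, pentagon, bwd_fwd, cmp_idr.
  now rewrite <- (cmp_assoc (_ ⋆ _) (_ ⋆ _)), <- hcomp_cmp_l, bwd_fwd, hcomp_id, cmp_idl.
Qed.

Lemma pentagon_3 :
  (assoc k h g ⋆ idm f) • bwd (assoc (k ∘ h) g f) =
  bwd (assoc k (h ∘ g) f) • ((idm k ⋆ bwd (assoc h g f)) • assoc k h (g ∘ f)).
Proof. now rewrite pentagon_2, bwd_fwd_pre. Qed.

Lemma pentagon_4 :
  (bwd (assoc k h g) ⋆ idm f) • bwd (assoc k (h ∘ g) f) =
  bwd (assoc (k ∘ h) g f) • (bwd (assoc k h (g ∘ f)) • (idm k ⋆ assoc h g f)).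
Proof.
  apply (iso_epi (i := assoc k (h ∘ g) f)); rewrite !cmp_assoc, bwd_fwd, cmp_idr.
  now rewrite pentagon_1, !bwd_fwd_pre.
Qed.
End Pentagons.

Definition transformation_comp (A B : Bicategory) (F G H : Pseudofunctor A B)
  (t : Transformation G H) (s : Transformation F G) : Transformation F H.
Proof.
  refine (@Build_Transformation A B F H (fun X => t X ∘ s X)
    (fun X Y f =>
       iso_cmp ((assoc (t Y) (s Y) (F ·₁ f))^-1)
      (iso_cmp (lwhisker_iso (t Y) (tnat s f))
      (iso_cmp (assoc (t Y) (G ·₁ f) (s X))
      (iso_cmp (rwhisker_iso (tnat t f) (s X))
               ((assoc (H ·₁ f) (t X) (s X))^-1))))) _ _ _); intros; cbn.
  - rewrite !cmp_assoc, <- hcomp_id, assoc_inv_nat.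
    rewrite <- (cmp_assoc (_ ⋆ _) (_ ⋆ _) (bwd _)), <- hcomp_cmp_r, tnat_nat, hcomp_cmp_r, !cmp_assoc.
    rewrite (cmp_pre (assoc_nat _ _ _)), cmp_assoc.
    rewrite <- (cmp_assoc (_ ⋆ _) (_ ⋆ _)), <- hcomp_cmp_l, tnat_nat, hcomp_cmp_l, !cmp_assoc.
    now rewrite (cmp_pre (assoc_inv_nat _ _ _)), hcomp_id, cmp_assoc.
  - rewrite !cmp_assoc, <- hcomp_id, assoc_inv_nat.
    rewrite <- (cmp_assoc (_ ⋆ _) (_ ⋆ _) (bwd _)), <- hcomp_cmp_r, tnat_id, !hcomp_cmp_r, !cmp_assoc.
    rewrite (cmp_pre (assoc_nat _ _ _)), cmp_assoc.
    rewrite <- (cmp_assoc (_ ⋆ _) (_ ⋆ _)), <- hcomp_cmp_l, tnat_id, !hcomp_cmp_l, !cmp_assoc.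
    rewrite (cmp_pre (assoc_inv_nat _ _ _)), hcomp_id, cmp_assoc; f_equal.
    rewrite <- (cmp_assoc (_ ⋆ fwd (lunit _))), triangle.
    rewrite <- (cmp_assoc (fwd (runit _) ⋆ _)), <- hcomp_cmp_r, fwd_bwd, hcomp_id, cmp_idl.
    rewrite <- lunit_comp, !cmp_assoc, fwd_bwd, cmp_idr, <- cmp_assoc; f_equal.
    apply (iso_mono (i := runit (t X ∘ s X))).
    rewrite fwd_bwd, <- runit_comp, cmp_assoc, fwd_bwd_pre, <- hcomp_cmp_l, fwd_bwd.
    apply hcomp_id.
  - rewrite !cmp_assoc, <- (hcomp_id (t X) (s X)), assoc_inv_nat.
    rewrite <- (cmp_assoc (_ ⋆ _) (_ ⋆ _) (bwd _)), <- hcomp_cmp_r, tnat_comp, !hcomp_cmp_r, !cmp_assoc.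
    rewrite (cmp_pre (assoc_nat _ _ _)), cmp_assoc.
    rewrite <- (cmp_assoc (_ ⋆ _) (_ ⋆ _)), <- hcomp_cmp_l, tnat_comp, !hcomp_cmp_l, !cmp_assoc.
    rewrite (cmp_pre (assoc_inv_nat _ _ _)), hcomp_id, cmp_assoc; f_equal.
    rewrite (cmp_pre (pentagon_1 _ _ _ _)), !cmp_assoc.
    rewrite <- (cmp_assoc (bwd _ ⋆ _) (fwd (assoc _ _ _) ⋆ _)).
    rewrite <- hcomp_cmp_r, bwd_fwd, hcomp_id, cmp_idl.
    rewrite (cmp_pre (assoc_nat _ _ (idm (s X)))), hcomp_id, cmp_assoc.
    rewrite (cmp_pre (eq_sym (assoc_nat (idm (t Z)) (idm (G ·₁ g)) (tnat s f)))), hcomp_id, cmp_assoc.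
    rewrite (cmp_pre (eq_sym (hcomp_lr (tnat t g) (tnat s f)))), cmp_assoc.
    rewrite pentagon_2, (cmp_pre (eq_sym (assoc_nat (idm (H ·₁ g)) (tnat t f) (idm (s X))))), cmp_assoc.
    rewrite (cmp_pre (pentagon_1 (H ·₁ g) _ _ _)), !cmp_assoc.
    rewrite (cmp_pre (eq_sym (assoc_nat (idm (H ·₁ g)) (idm (t Y)) (tnat s f)))), hcomp_id, cmp_assoc.
    rewrite (cmp_pre (pentagon_2 (H ·₁ g) _ _ _)), !cmp_assoc, bwd_fwd_pre.
    rewrite <- (cmp_assoc (bwd (assoc (H ·₁ g) _ _) ⋆ _) (fwd (assoc _ _ _) ⋆ _)).
    rewrite <- hcomp_cmp_r, bwd_fwd, hcomp_id, cmp_idl.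
    rewrite (cmp_pre (eq_sym (assoc_inv_nat (tnat t g) (idm (s Y)) (idm (F ·₁ f))))), hcomp_id, cmp_assoc.
    rewrite (cmp_pre (pentagon_3 _ _ _ _)), !cmp_assoc.
    rewrite (cmp_pre (eq_sym (assoc_inv_nat (idm (t Z)) (tnat s g) (idm (F ·₁ f))))), cmp_assoc.
    now rewrite (cmp_pre (pentagon_4 _ _ _ _)), !cmp_assoc, fwd_bwd_pre.
Defined.

Section PseudofunctorCalculus.
Variables (B C : Bicategory) (K : Pseudofunctor B C).

Lemma pcomp_nat_l X Y Z (g : @hom B Y Z) (f f' : hom X Y) (a : mor f f') :
  pcomp K g f' • (idm (K ·₁ g) ⋆ K ·₂ a) = K ·₂ (idm g ⋆ a) • pcomp K g f.
Proof. now rewrite pcomp_nat, fmor_id. Qed.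

Lemma pcomp_nat_r X Y Z (g g' : @hom B Y Z) (f : hom X Y) (b : mor g g') :
  pcomp K g' f • (K ·₂ b ⋆ idm (K ·₁ f)) = K ·₂ (b ⋆ idm f) • pcomp K g f.
Proof. now rewrite pcomp_nat, fmor_id. Qed.

Lemma pcomp_inv_nat_l X Y Z (g : @hom B Y Z) (f f' : hom X Y) (a : mor f f') :
  bwd (pcomp K g f') • K ·₂ (idm g ⋆ a) = (idm (K ·₁ g) ⋆ K ·₂ a) • bwd (pcomp K g f).
Proof. symmetry; apply iso_conj, pcomp_nat_l. Qed.

Lemma pcomp_assoc_fwd W X Y Z (h : @hom B Y Z) (g : hom X Y) (f : hom W X) :
  K ·₂ (assoc h g f) • pcomp K (h ∘ g) f =
  pcomp K h (g ∘ f) • ((idm (K ·₁ h) ⋆ pcomp K g f) •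
    (assoc _ _ _ • (bwd (pcomp K h g) ⋆ idm (K ·₁ f)))).
Proof.
  apply (iso_epi (i := rwhisker_iso (pcomp K h g) (K ·₁ f))); cbn.
  rewrite !cmp_assoc, pcomp_assoc, <- hcomp_cmp_r, bwd_fwd, hcomp_id.
  now rewrite cmp_idr.
Qed.

Lemma pcomp_assoc_bwd W X Y Z (h : @hom B Y Z) (g : hom X Y) (f : hom W X) :
  K ·₂ (bwd (assoc h g f)) • pcomp K h (g ∘ f) =
  pcomp K (h ∘ g) f • ((pcomp K h g ⋆ idm (K ·₁ f)) •
    (bwd (assoc _ _ _) • (idm (K ·₁ h) ⋆ bwd (pcomp K g f)))).
Proof.
  apply (iso_mono (i := functor_iso (ploc K _ _) (assoc h g f))); cbn.
  rewrite <- cmp_assoc, <- fmor_cmp, fwd_bwd, fmor_id, cmp_idl.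
  rewrite (cmp_pre (pcomp_assoc_fwd _ _ _)), !cmp_assoc.
  rewrite <- (cmp_assoc (bwd _ ⋆ _) (fwd _ ⋆ _)), <- hcomp_cmp_r, bwd_fwd, hcomp_id, cmp_idl.
  rewrite fwd_bwd_pre, <- hcomp_cmp_l, fwd_bwd, hcomp_id; now rewrite cmp_idr.
Qed.
End PseudofunctorCalculus.

Definition prewhisker (A B C : Bicategory) (G G' : Pseudofunctor B C)
  (s : Transformation G G') (F : Pseudofunctor A B) :
  Transformation (pseudofunctor_comp G F) (pseudofunctor_comp G' F).
Proof.
  refine (@Build_Transformation A C (pseudofunctor_comp G F) (pseudofunctor_comp G' F)
    (fun X => s (F X)) (fun X Y f => tnat s (F ·₁ f)) _ _ _); intros; cbn.
  - apply tnat_nat.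
  - now rewrite hcomp_cmp_r, (cmp_pre (tnat_nat _ _)), cmp_assoc, tnat_id, hcomp_cmp_l, cmp_assoc.
  - now rewrite hcomp_cmp_r, (cmp_pre (tnat_nat _ _)), cmp_assoc, tnat_comp, hcomp_cmp_l, cmp_assoc.
Defined.

Definition postwhisker (A B C : Bicategory) (K : Pseudofunctor B C)
  (F G : Pseudofunctor A B) (s : Transformation F G) :
  Transformation (pseudofunctor_comp K F) (pseudofunctor_comp K G).
Proof.
  refine (@Build_Transformation A C (pseudofunctor_comp K F) (pseudofunctor_comp K G)
    (fun X => K ·₁ s X)
    (fun X Y f =>
       iso_cmp ((pcomp K (s Y) (F ·₁ f))^-1)
      (iso_cmp (functor_iso (ploc K _ _) (tnat s f)) (pcomp K (G ·₁ f) (s X)))) _ _ _);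
  intros; cbn.
  - rewrite !cmp_assoc, pcomp_nat_r.
    rewrite <- (cmp_assoc (K ·₂ _) (K ·₂ _)), <- fmor_cmp, tnat_nat, fmor_cmp, cmp_assoc.
    now rewrite (cmp_pre (pcomp_inv_nat_l _ _ _)), cmp_assoc.
  - rewrite hcomp_cmp_r, hcomp_cmp_l, !cmp_assoc, (cmp_pre (pcomp_nat_r _ _ _)), cmp_assoc.
    rewrite <- (cmp_assoc (K ·₂ _) (K ·₂ _)), <- fmor_cmp, tnat_id, !fmor_cmp, !cmp_assoc.
    rewrite (cmp_pre (pcomp_inv_nat_l _ _ _)), !cmp_assoc, pid_l; f_equal.
    rewrite <- (cmp_assoc (bwd _) (K ·₂ _)), <- (cmp_assoc (_ ⋆ _) (bwd _)); f_equal.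
    apply (iso_epi (i := runit (K ·₁ s X))); rewrite !cmp_assoc, bwd_fwd, cmp_idr, <- pid_r.
    now rewrite <- (cmp_assoc (K ·₂ _) (K ·₂ _)), <- fmor_cmp, bwd_fwd, fmor_id, cmp_idl, bwd_fwd_pre.
  - rewrite (hcomp_cmp_r _ (K ·₂ _)), (hcomp_cmp_l _ (K ·₂ _) (fwd (pcomp K _ _))).
    rewrite !cmp_assoc, (cmp_pre (pcomp_nat_r _ _ _)), cmp_assoc.
    rewrite <- (cmp_assoc (K ·₂ _) (K ·₂ _)), <- fmor_cmp, tnat_comp, !fmor_cmp, !cmp_assoc.
    rewrite (cmp_pre (pcomp_inv_nat_l _ _ _)), !cmp_assoc; f_equal.
    rewrite pcomp_assoc.
    rewrite (cmp_pre (eq_sym (pcomp_nat_l K (G ·₁ g) (tnat s f)))), cmp_assoc.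
    rewrite (cmp_pre (pcomp_assoc_bwd _ _ _ _)), !cmp_assoc.
    rewrite (cmp_pre (eq_sym (pcomp_nat_r K (F ·₁ f) (tnat s g)))), cmp_assoc.
    rewrite (cmp_pre (pcomp_assoc_fwd _ _ _ _)), !cmp_assoc, bwd_fwd_pre.
    now rewrite !hcomp_cmp_r, !hcomp_cmp_l, !cmp_assoc.
Defined.

(* The composites [1 ∘ F], [F ∘ 1] and the two bracketings of [K ∘ G ∘ F] agree strictly on
   objects, 1-morphisms and 2-morphisms, and their coherence isomorphisms agree up to provable
   equality: the unitors and associators of pseudofunctor composition have identity components.
   The next six definitions absorb them, changing neither components nor naturality cells. *)

Section Absorption.
Variables (A B C D : Bicategory).

Definition source_unitl (F G : Pseudofunctor A B)
  (s : Transformation (pseudofunctor_comp (pseudofunctor_id B) F) G) : Transformation F G.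
Proof.
  refine (@Build_Transformation A B F G (tob s) (fun X Y f => tnat s f) _ _ _); intros.
  - exact (tnat_nat s a).
  - generalize (tnat_id s X); cbn; now rewrite cmp_idr.
  - generalize (tnat_comp s g f); cbn; now rewrite cmp_idr.
Defined.

Definition source_unitr (F G : Pseudofunctor A B)
  (s : Transformation (pseudofunctor_comp F (pseudofunctor_id A)) G) : Transformation F G.
Proof.
  refine (@Build_Transformation A B F G (tob s) (fun X Y f => tnat s f) _ _ _); intros.
  - exact (tnat_nat s a).
  - generalize (tnat_id s X); cbn; now rewrite fmor_id, cmp_idl.
  - generalize (tnat_comp s g f); cbn; now rewrite fmor_id, cmp_idl.
Defined.

Definition target_unitl (F G : Pseudofunctor A B)
  (s : Transformation F (pseudofunctor_comp (pseudofunctor_id B) G)) : Transformation F G.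
Proof.
  refine (@Build_Transformation A B F G (tob s) (fun X Y f => tnat s f) _ _ _); intros.
  - exact (tnat_nat s a).
  - generalize (tnat_id s X); cbn; now rewrite cmp_idr.
  - generalize (tnat_comp s g f); cbn; now rewrite cmp_idr.
Defined.

Definition target_unitr (F G : Pseudofunctor A B)
  (s : Transformation F (pseudofunctor_comp G (pseudofunctor_id A))) : Transformation F G.
Proof.
  refine (@Build_Transformation A B F G (tob s) (fun X Y f => tnat s f) _ _ _); intros.
  - exact (tnat_nat s a).
  - generalize (tnat_id s X); cbn; now rewrite fmor_id, cmp_idl.
  - generalize (tnat_comp s g f); cbn; now rewrite fmor_id, cmp_idl.
Defined.

Definition target_assocl (E : Pseudofunctor A D)
  (F : Pseudofunctor A B) (G : Pseudofunctor B C) (K : Pseudofunctor C D)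
  (s : Transformation E (pseudofunctor_comp K (pseudofunctor_comp G F))) :
  Transformation E (pseudofunctor_comp (pseudofunctor_comp K G) F).
Proof.
  refine (@Build_Transformation A D E (pseudofunctor_comp (pseudofunctor_comp K G) F)
    (tob s) (fun X Y f => tnat s f) _ _ _); intros.
  - exact (tnat_nat s a).
  - generalize (tnat_id s X); cbn; now rewrite fmor_cmp, cmp_assoc.
  - generalize (tnat_comp s g f); cbn; now rewrite fmor_cmp, cmp_assoc.
Defined.

Definition target_assocr (E : Pseudofunctor A D)
  (F : Pseudofunctor A B) (G : Pseudofunctor B C) (K : Pseudofunctor C D)
  (s : Transformation E (pseudofunctor_comp (pseudofunctor_comp K G) F)) :
  Transformation E (pseudofunctor_comp K (pseudofunctor_comp G F)).
Proof.
  refine (@Build_Transformation A D E (pseudofunctor_comp K (pseudofunctor_comp G F))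
    (tob s) (fun X Y f => tnat s f) _ _ _); intros.
  - exact (tnat_nat s a).
  - generalize (tnat_id s X); cbn; now rewrite fmor_cmp, cmp_assoc.
  - generalize (tnat_comp s g f); cbn; now rewrite fmor_cmp, cmp_assoc.
Defined.
End Absorption.

Record Modification (A B : Bicategory) (F G : Pseudofunctor A B) (s t : Transformation F G) := {
  mob :> forall X : A, mor (s X) (t X);
  mnat : forall (X Y : A) (f : hom X Y),
    (mob Y ⋆ idm (F ·₁ f)) • tnat s f = tnat t f • (idm (G ·₁ f) ⋆ mob X)
}.

Definition invertible_modification (A B : Bicategory) (F G : Pseudofunctor A B)
  (s t : Transformation F G) (m : Modification s t) : Prop :=
  forall X : A, invertible (m X).

Definition modification_rwhisker (A B : Bicategory) (F G H : Pseudofunctor A B)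
  (s t : Transformation G H) (m : Modification s t) (p : Transformation F G) :
  Modification (transformation_comp s p) (transformation_comp t p).
Proof.
  refine (@Build_Modification A B F H (transformation_comp s p) (transformation_comp t p)
    (fun X => m X ⋆ idm (p X)) _); intros; cbn.
  rewrite !cmp_assoc, (cmp_pre (eq_sym (assoc_inv_nat _ _ _))), hcomp_id, cmp_assoc.
  rewrite (cmp_pre (hcomp_lr _ _)), cmp_assoc, <- hcomp_id.
  rewrite (cmp_pre (eq_sym (assoc_nat _ _ _))), cmp_assoc.
  rewrite <- (cmp_assoc ((_ ⋆ _) ⋆ _) (_ ⋆ _)), <- hcomp_cmp_r, mnat, hcomp_cmp_r, cmp_assoc.
  now rewrite <- assoc_inv_nat.
Defined.

Definition pseudonatural_equivalence (A B : Bicategory) (F G : Pseudofunctor A B)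
  (s : Transformation F G) : Prop :=
  exists t : Transformation G F,
    (exists m : Modification (transformation_comp t s) (transformation_id F),
       invertible_modification m) /\
    (exists m : Modification (transformation_comp s t) (transformation_id G),
       invertible_modification m).

Section UnitCounitWhiskering.
Variables A B : Bicategory.

Definition unit_prewhisker (T : Pseudofunctor A A)
  (h : Transformation (pseudofunctor_id A) T) (F : Pseudofunctor B A) :
  Transformation F (pseudofunctor_comp T F) :=
  source_unitl (prewhisker h F).

Definition unit_postwhisker (F : Pseudofunctor A B) (T : Pseudofunctor A A)
  (h : Transformation (pseudofunctor_id A) T) :
  Transformation F (pseudofunctor_comp F T) :=
  source_unitr (postwhisker F h).

Definition counit_prewhisker (T : Pseudofunctor B B)
  (e : Transformation T (pseudofunctor_id B)) (F : Pseudofunctor A B) :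
  Transformation (pseudofunctor_comp T F) F :=
  target_unitl (prewhisker e F).

Definition counit_postwhisker (F : Pseudofunctor B A) (T : Pseudofunctor B B)
  (e : Transformation T (pseudofunctor_id B)) :
  Transformation (pseudofunctor_comp F T) F :=
  target_unitr (postwhisker F e).
End UnitCounitWhiskering.

Record Biadjunction (A B : Bicategory) (L : Pseudofunctor A B) (R : Pseudofunctor B A) := {
  biadj_unit : Transformation (pseudofunctor_id A) (pseudofunctor_comp R L);
  biadj_counit : Transformation (pseudofunctor_comp L R) (pseudofunctor_id B);
  biadj_left : Modification
    (transformation_comp (counit_prewhisker biadj_counit L)
                         (target_assocl (unit_postwhisker L biadj_unit)))
    (transformation_id L);
  biadj_left_inv : invertible_modification biadj_left;
  biadj_right : Modification
    (transformation_comp (counit_postwhisker R biadj_counit)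
                         (target_assocr (unit_prewhisker biadj_unit R)))
    (transformation_id R);
  biadj_right_inv : invertible_modification biadj_right
}.

Definition is_left_biadjoint (A B : Bicategory) (L : Pseudofunctor A B)
  (R : Pseudofunctor B A) : Prop := inhabited (Biadjunction L R).

(* Main.v *)
(* Write [T = HN] and let [e : X -> M' X] be the 1-morphism with [Λ ∘ e ≅ Ψ X], which exists since
   [Ψ X] is an inverter cone. The retraction [ε ∘ N Λ] of [N e] is an equivalence inverse: since
   [T Λ] is pseudomonic and [Ψ ∘ Λ ≅ T Ψ ∘ Λ], the composite [T e ∘ H (ε ∘ N Λ)] is isomorphic to the
   identity, and transposition along [N ⊣ H] reflects this. Likewise [Ψ (M' X) ≅ T e ∘ Λ], and naturality
   of [μ'] along [e] carries the inverter [Λ] of [μ' X] to the inverter [Ψ (M' X)] of [μ' (M' X)], so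
   that [M' X] lies in the essential image of [G]. Moreover precomposition with [e] is an equivalence
   on homs into objects [H Y], therefore on homs into inverters of 2-morphisms between such objects,
   therefore on homs into objects [G Y]. So [X -> M' X ≃ G (M X)] is a universal arrow, and universal
   arrows assemble into a left biadjoint: all data are lifted along the unit, and all axioms are
   checked after applying [G] and whiskering with the unit. *)

From Stdlib Require Import IndefiniteDescription Setoid Morphisms.
Require Import Defs.

Set Implicit Arguments.
Unset Strict Implicit.
Unset Printing Implicit Defensive.

(* Conversion should unfold the projections of pseudofunctors and transformations first, and should
   compare composite isomorphisms structurally, not through the proofs contained in them. *)
Strategy 100 [iso_cmp iso_inv iso_id hcomp_iso lwhisker_iso rwhisker_iso functor_iso].
Strategy -100 [tnat tob pob ploc fob].

(** Being an equivalence, an inverter or a universal arrow is a property, so up to the universal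
    arrows most comparisons of 1-morphisms need only mere isomorphism [≅], handled by setoid
    rewriting; specific cells enter where naturality in 2-morphisms is at stake. Transposition is
    indispensable there: pseudomonicity of [HN Λ] compares 1-morphisms of [C], whereas an inverse of
    [N e] lives in [A].

    Assembling the biadjunction does require equations between cells, and its obstacle is the
    bookkeeping of associators. Cells are therefore whiskered with an arbitrary 1-morphism [x] and
    bracketed to the right, so that composites of 1-morphisms become iterated applications to [x]
    and the axioms of a pseudofunctor lose the associators of its target.

    The counit is obtained by factoring the identity of [G] through the unit at [G]. This provides
    the right triangle isomorphism together with its modification axiom, so that only the left
    triangle demands a separate argument. *)

Definition isomorphic (C : Category) (x y : C) : Prop := inhabited (Iso x y).
Notation "x ≅ y" := (isomorphic x y) (at level 70, no associativity) : bicat_scope.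

#[export] Instance isomorphic_equivalence (C : Category) : Equivalence (@isomorphic C).
Proof.
  split.
  - intros x; exact (inhabits (iso_id x)).
  - intros x y [i]; exact (inhabits (i^-1)).
  - intros x y z [i] [j]; exact (inhabits (iso_cmp j i)).
Qed.

#[export] Instance functor_isomorphic (C D : Category) (F : Functor C D) :
  Proper (@isomorphic C ==> @isomorphic D) (fob F).
Proof. intros x y [i]; exact (inhabits (functor_iso F i)). Qed.

#[export] Instance comp1_isomorphic (B : Bicategory) (X Y Z : B) :
  Proper (@isomorphic (hom Y Z) ==> @isomorphic (hom X Y) ==> @isomorphic (hom X Z))
    (@comp1 B X Y Z).
Proof. intros g g' [j] f f' [i]; exact (inhabits (hcomp_iso j i)). Qed.

(** * Weak equivalences of categories and their cancellation properties *)

Section WeakEquivalences.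

Definition full (C D : Category) (F : Functor C D) : Prop :=
  forall x y (b : mor (F x) (F y)), exists a : mor x y, fmor F a = b.

Definition essentially_surjective (C D : Category) (F : Functor C D) : Prop :=
  forall y, exists x, F x ≅ y.

Definition fully_faithful_functor (C D : Category) (F : Functor C D) : Prop := faithful F /\ full F.

Definition weak_equivalence (C D : Category) (F : Functor C D) : Prop :=
  fully_faithful_functor F /\ essentially_surjective F.

Lemma invertible_iso (C : Category) (x y : C) (a : mor x y) :
  invertible a -> exists i : Iso x y, fwd i = a.
Proof. intros [b [H1 H2]]; now exists (Build_Iso H1 H2). Qed.

Lemma invertible_iff_conj (D : Category) (x y x' y' : D) (i : Iso x y) (j : Iso x' y')
  (a : mor x x') (b : mor y y') : j • a = b • i -> (invertible a <-> invertible b).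
Proof.
  intros E; split; intros Hi.
  - replace b with (j • (a • bwd i));
      [|now rewrite <- cmp_assoc, E, cmp_assoc, fwd_bwd, cmp_idr].
    apply invertible_cmp; [apply iso_invertible|].
    apply invertible_cmp; [exact Hi | exact (iso_invertible (i^-1))].
  - replace a with (bwd j • (b • i)); [|now rewrite <- E, bwd_fwd_pre].
    apply invertible_cmp; [exact (iso_invertible (j^-1))|].
    apply invertible_cmp; [exact Hi | apply iso_invertible].
Qed.

Lemma fully_faithful_reflects_invertible (C D : Category) (F : Functor C D) (x y : C) (a : mor x y) :
  fully_faithful_functor F -> invertible (fmor F a) -> invertible a.
Proof.
  intros [Ffaith Ffull] [b [H1 H2]]; destruct (Ffull _ _ b) as [c <-].
  exists c; split; apply Ffaith; now rewrite fmor_cmp, fmor_id.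
Qed.

Lemma fully_faithful_reflects_isomorphic (C D : Category) (F : Functor C D) (x y : C) :
  fully_faithful_functor F -> F x ≅ F y -> x ≅ y.
Proof.
  intros HF [i]; destruct (proj2 HF _ _ (fwd i)) as [a Ha].
  destruct (@invertible_iso _ _ _ a) as [j _]; [| exact (inhabits j)].
  apply (fully_faithful_reflects_invertible HF); rewrite Ha; apply iso_invertible.
Qed.

Lemma fully_faithful_natiso (C D : Category) (F G : Functor C D) (n : NatIso F G) :
  fully_faithful_functor F -> fully_faithful_functor G.
Proof.
  assert (E : forall x y (a : mor x y), fmor F a = bwd (n y) • (fmor G a • n x))
    by (intros; apply fwd_to_bwd, nat_iso_nat).
  intros [Ffaith Ffull]; split.
  - intros x y a b Hab; apply Ffaith; now rewrite !E, Hab.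
  - intros x y b; destruct (Ffull _ _ (bwd (n y) • (b • n x))) as [a Ha]; exists a.
    rewrite E in Ha; apply (iso_epi (i := n x)), (iso_mono (i := (n y)^-1)); exact Ha.
Qed.

Lemma fully_faithful_id (C : Category) : fully_faithful_functor (functor_id C).
Proof. split; [intros x y a b H; exact H | intros x y b; now exists b]. Qed.

Lemma fully_faithful_comp (C D E : Category) (G : Functor D E) (F : Functor C D) :
  fully_faithful_functor G -> fully_faithful_functor F -> fully_faithful_functor (functor_comp G F).
Proof.
  intros [G1 G2] [F1 F2]; split.
  - intros x y a b H; apply F1, G1, H.
  - intros x y b; destruct (G2 _ _ b) as [c Hc]; destruct (F2 _ _ c) as [a Ha].
    exists a; cbn; now rewrite Ha.
Qed.

Lemma fully_faithful_cancel_l (C D E : Category) (G : Functor D E) (F : Functor C D) :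
  fully_faithful_functor G -> fully_faithful_functor (functor_comp G F) -> fully_faithful_functor F.
Proof.
  intros [G1 G2] [H1 H2]; split.
  - intros x y a b H; apply H1; cbn; now rewrite H.
  - intros x y b; destruct (H2 _ _ (fmor G b)) as [a Ha]; exists a; apply G1, Ha.
Qed.

(** Essential surjectivity replaces objects of [D] by isomorphic values of [F], and between those
    fullness of [F] reduces everything to the composite. *)
Lemma fully_faithful_cancel_r (C D E : Category) (G : Functor D E) (F : Functor C D) :
  weak_equivalence F -> fully_faithful_functor (functor_comp G F) -> fully_faithful_functor G.
Proof.
  intros [[F1 F2] F3] [H1 H2]; split.
  - intros x y a b H; destruct (F3 x) as [x' [i]], (F3 y) as [y' [j]].
    destruct (F2 _ _ (bwd j • (a • i))) as [a' Ha], (F2 _ _ (bwd j • (b • i))) as [b' Hb].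
    apply (iso_epi (i := i)), (iso_mono (i := j^-1)); cbn.
    rewrite <- Ha, <- Hb; f_equal; apply H1; cbn.
    now rewrite Ha, Hb, !fmor_cmp, H.
  - intros x y b; destruct (F3 x) as [x' [i]], (F3 y) as [y' [j]].
    destruct (H2 _ _ (fmor G (bwd j) • (b • fmor G i))) as [a Ha]; cbn in Ha.
    exists (j • (fmor F a • bwd i)); rewrite !fmor_cmp, Ha.
    rewrite !cmp_assoc, <- (fmor_cmp G i), fwd_bwd, fmor_id, cmp_idr.
    now rewrite <- cmp_assoc, <- fmor_cmp, fwd_bwd, fmor_id, cmp_idl.
Qed.

Lemma weak_equivalence_natiso (C D : Category) (F G : Functor C D) (n : NatIso F G) :
  weak_equivalence F -> weak_equivalence G.
Proof.
  intros [H1 H2]; split; [exact (fully_faithful_natiso n H1)|].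
  intros y; destruct (H2 y) as [x Hx]; exists x.
  rewrite <- Hx; symmetry; exact (inhabits (n x : Iso _ _)).
Qed.

Lemma weak_equivalence_comp (C D E : Category) (G : Functor D E) (F : Functor C D) :
  weak_equivalence G -> weak_equivalence F -> weak_equivalence (functor_comp G F).
Proof.
  intros [G1 G2] [F1 F2]; split; [now apply fully_faithful_comp|].
  intros z; destruct (G2 z) as [y Hy]; destruct (F2 y) as [x Hx].
  exists x; cbn; now rewrite Hx.
Qed.

Lemma weak_equivalence_cancel_r (C D E : Category) (G : Functor D E) (F : Functor C D) :
  weak_equivalence F -> weak_equivalence (functor_comp G F) -> weak_equivalence G.
Proof.
  intros HF [H1 H2]; split; [exact (fully_faithful_cancel_r HF H1)|].
  intros z; destruct (H2 z) as [x Hx]; now exists (F x).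
Qed.

Lemma natiso_sym (C D : Category) (F G : Functor C D) : NatIso F G -> NatIso G F.
Proof.
  intros n; refine {| nat_iso := fun x => (n x)^-1 |}.
  intros; cbn; symmetry; apply iso_conj, nat_iso_nat.
Defined.

Definition natiso_trans (C D : Category) (F G H : Functor C D) (m : NatIso G H) (n : NatIso F G) :
  NatIso F H.
Proof.
  refine {| nat_iso := fun x => iso_cmp (m x) (n x) |}.
  intros; cbn; now rewrite cmp_assoc, nat_iso_nat, (cmp_pre (nat_iso_nat _ _)), cmp_assoc.
Defined.

Definition natiso_rwhisker (C D E : Category) (F F' : Functor D E) (n : NatIso F F') (K : Functor C D) :
  NatIso (functor_comp F K) (functor_comp F' K).
Proof.
  refine (@Build_NatIso _ _ (functor_comp F K) (functor_comp F' K) (fun x => n (K x) : Iso _ _) _).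
  intros; cbn; apply nat_iso_nat.
Defined.

Lemma equivalence_weak (C D : Category) (F : Functor C D) :
  is_equivalence_of_categories F -> weak_equivalence F.
Proof.
  intros [G [[n] [m]]]; split.
  - assert (HGF := fully_faithful_natiso (natiso_sym n) (fully_faithful_id C)).
    assert (HFG := fully_faithful_natiso (natiso_sym m) (fully_faithful_id D)).
    assert (Ffaith : faithful F).
    { intros x y a b H; apply (proj1 HGF); cbn; now rewrite H. }
    assert (Gfaith : faithful G).
    { intros x y a b H; apply (proj1 HFG); cbn; now rewrite H. }
    split; [exact Ffaith|].
    intros x y b; destruct (proj2 HGF _ _ (fmor G b)) as [a Ha].
    exists a; apply Gfaith, Ha.
  - intros y; exists (G y); exact (inhabits (m y : Iso _ _)).
Qed.

Lemma weak_equivalence_is_equivalence (C D : Category) (F : Functor C D) :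
  weak_equivalence F -> is_equivalence_of_categories F.
Proof.
  intros [[F1 F2] F3].
  assert (c : forall y, {x : C & Iso (F x) y}).
  { intros y; destruct (constructive_indefinite_description _ (F3 y)) as [x Hx].
    exists x.
    (* [F x ≅ y] only asserts that an isomorphism exists. Choosing with the trivial predicate
       extracts one as data. *)
    destruct (constructive_indefinite_description (fun _ : Iso (F x) y => True)) as [i _];
      [destruct Hx as [i]; now exists i | exact i]. }
  assert (l : forall x y (b : mor (F x) (F y)), {a : mor x y | fmor F a = b})
    by (intros; apply constructive_indefinite_description, F2).
  pose (g := fun y => projT1 (c y)); pose (i := fun y => projT2 (c y) : Iso (F (g y)) y).
  pose (gm := fun y y' (b : mor y y') => proj1_sig (l (g y) (g y') (bwd (i y') • (b • i y)))).
  assert (Hgm : forall y y' (b : mor y y'), fmor F (gm y y' b) = bwd (i y') • (b • i y))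
    by (intros; apply (proj2_sig (l _ _ _))).
  pose (G := @Build_Functor D C g gm
    ltac:(intros; apply F1; now rewrite Hgm, fmor_id, cmp_idl, bwd_fwd)
    ltac:(intros; apply F1; now rewrite fmor_cmp, !Hgm, !cmp_assoc, fwd_bwd_pre)).
  exists G; split.
  - assert (li : forall x, {j : Iso (g (F x)) x | fmor F j = i (F x)}).
    { intros x; apply constructive_indefinite_description.
      destruct (F2 _ _ (fwd (i (F x)))) as [a Ha].
      destruct (@invertible_iso _ _ _ a) as [j Hj];
        [| exists j; now rewrite Hj].
      apply (fully_faithful_reflects_invertible (conj F1 F2)); rewrite Ha; apply iso_invertible. }
    refine (inhabits (@Build_NatIso _ _ (functor_comp G F) (functor_id C)
              (fun x => proj1_sig (li x)) _)).
    intros x y a; cbn; apply F1; rewrite !fmor_cmp, !(proj2_sig (li _)), Hgm.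
    now rewrite fwd_bwd_pre.
  - refine (inhabits (@Build_NatIso _ _ (functor_comp F G) (functor_id D) i _)).
    intros x y a; cbn; now rewrite Hgm, fwd_bwd_pre.
Qed.

Lemma pseudomonic_reflects_isomorphic (C D : Category) (F : Functor C D) :
  pseudomonic_functor F -> forall x y, F x ≅ F y -> x ≅ y.
Proof. intros [_ H] x y [i]; destruct (H x y i) as [j _]; exact (inhabits j). Qed.

End WeakEquivalences.

(** * 1-morphisms up to isomorphism *)

Section OneMorphisms.
Variable B : Bicategory.
Implicit Types V W X Y Z : B.

Lemma comp1_assoc W X Y Z (h : hom Y Z) (g : hom X Y) (f : hom W X) :
  (h ∘ g) ∘ f ≅ h ∘ (g ∘ f).
Proof. exact (inhabits (assoc h g f)). Qed.

Lemma comp1_idl X Y (f : hom X Y) : id1 Y ∘ f ≅ f.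
Proof. exact (inhabits (lunit f)). Qed.

Lemma comp1_idr X Y (f : hom X Y) : f ∘ id1 X ≅ f.
Proof. exact (inhabits (runit f)). Qed.

Lemma assoc_nat_l W X Y Z (h h' : hom Y Z) (g : hom X Y) (f : hom W X) (c : mor h h') :
  assoc h' g f • ((c ⋆ idm g) ⋆ idm f) = (c ⋆ idm (g ∘ f)) • assoc h g f.
Proof. rewrite <- hcomp_id; apply assoc_nat. Qed.

Lemma assoc_nat_r W X Y Z (h : hom Y Z) (g : hom X Y) (f f' : hom W X) (a : mor f f') :
  assoc h g f' • (idm (h ∘ g) ⋆ a) = (idm h ⋆ (idm g ⋆ a)) • assoc h g f.
Proof. rewrite <- hcomp_id; apply assoc_nat. Qed.

Definition precomp W X Y (f : hom W X) : Functor (hom X Y) (hom W Y).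
Proof.
  refine {| fob := fun k : hom X Y => k ∘ f; fmor := fun _ _ a => a ⋆ idm f |}.
  - intros; apply hcomp_id.
  - intros; apply hcomp_cmp_r.
Defined.

Lemma postcomp_cast W X Y (f f' : hom X Y) (i : Iso f f') :
  NatIso (postcomp W f) (postcomp W f').
Proof.
  refine {| nat_iso := fun k => rwhisker_iso i k : Iso (postcomp W f k) (postcomp W f' k) |}.
  intros; cbn; apply hcomp_lr.
Defined.

Lemma postcomp_comp W X Y Z (g : hom Y Z) (f : hom X Y) :
  NatIso (postcomp W (g ∘ f)) (functor_comp (postcomp W g) (postcomp W f)).
Proof.
  refine {| nat_iso := fun k =>
    assoc g f k : Iso (postcomp W (g ∘ f) k) (functor_comp (postcomp W g) (postcomp W f) k) |}.
  intros; cbn; apply assoc_nat_r.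
Defined.

Lemma postcomp_id W X : NatIso (postcomp W (id1 X)) (functor_id _).
Proof.
  refine {| nat_iso := fun k =>
    lunit k : Iso (postcomp W (id1 X) k) (functor_id _ k) |}.
  intros; cbn; apply lunit_nat.
Defined.

Lemma precomp_cast X Y Z (f f' : hom X Y) (i : Iso f f') :
  NatIso (precomp Z f) (precomp Z f').
Proof.
  refine {| nat_iso := fun k => lwhisker_iso k i : Iso (precomp Z f k) (precomp Z f' k) |}.
  intros; cbn; symmetry; apply hcomp_lr.
Defined.

Lemma precomp_comp W X Y Z (g : hom X Y) (f : hom W X) :
  NatIso (functor_comp (precomp Z f) (precomp Z g)) (precomp Z (g ∘ f)).
Proof.
  refine {| nat_iso := fun k =>
    assoc k g f : Iso (functor_comp (precomp Z f) (precomp Z g) k) (precomp Z (g ∘ f) k) |}.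
  intros; cbn; apply assoc_nat_l.
Defined.

Lemma precomp_id X Z : NatIso (precomp Z (id1 X)) (functor_id _).
Proof.
  refine {| nat_iso := fun k =>
    runit k : Iso (precomp Z (id1 X) k) (functor_id _ k) |}.
  intros; cbn; apply runit_nat.
Defined.

Lemma precomp_postcomp W X Y Z (g : hom Y Z) (f : hom W X) :
  NatIso (functor_comp (precomp Z f) (postcomp X g)) (functor_comp (postcomp W g) (precomp Y f)).
Proof.
  refine {| nat_iso := fun k => assoc g k f :
    Iso (functor_comp (precomp Z f) (postcomp X g) k) (functor_comp (postcomp W g) (precomp Y f) k) |}.
  intros; cbn; apply assoc_nat.
Defined.

Lemma equivalence_postcomp W X Y (f : hom X Y) :
  is_equivalence f -> weak_equivalence (postcomp W f).
Proof.
  intros [g [[i] [j]]]; apply equivalence_weak; exists (postcomp W g); split; constructor.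
  - exact (natiso_trans (postcomp_id W X)
             (natiso_trans (postcomp_cast W i) (natiso_sym (postcomp_comp W g f)))).
  - exact (natiso_trans (postcomp_id W Y)
             (natiso_trans (postcomp_cast W j) (natiso_sym (postcomp_comp W f g)))).
Qed.

Lemma equivalence_precomp X Y Z (f : hom X Y) :
  is_equivalence f -> weak_equivalence (precomp Z f).
Proof.
  intros [g [[i] [j]]]; apply equivalence_weak; exists (precomp Z g); split; constructor.
  - exact (natiso_trans (precomp_id Y Z) (natiso_trans (precomp_cast Z j) (precomp_comp Z f g))).
  - exact (natiso_trans (precomp_id X Z) (natiso_trans (precomp_cast Z i) (precomp_comp Z g f))).
Qed.

Lemma invertible_rwhisker X Y Z (g g' : hom Y Z) (phi : mor g g') (f : hom X Y) :
  invertible phi -> invertible (phi ⋆ idm f).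
Proof.
  intros H; destruct (invertible_iso H) as [i <-]; exact (iso_invertible (rwhisker_iso i f)).
Qed.

Lemma invertible_whisker_iso X Y Z (g g' : hom Y Z) (phi : mor g g') (f f' : hom X Y) :
  f ≅ f' -> invertible (phi ⋆ idm f) -> invertible (phi ⋆ idm f').
Proof.
  intros [i] H.
  replace (phi ⋆ idm f') with ((idm g' ⋆ fwd i) • ((phi ⋆ idm f) • (idm g ⋆ bwd i))).
  - apply invertible_cmp; [exact (iso_invertible (lwhisker_iso g' i))|].
    apply invertible_cmp; [exact H | exact (iso_invertible (lwhisker_iso g (i^-1)))].
  - now rewrite <- !hcomp_cmp, !cmp_idl, !cmp_idr, fwd_bwd.
Qed.

Lemma invertible_whisker_comp X Y Z W (g g' : hom Y Z) (phi : mor g g') (f : hom X Y) (k : hom W X) :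
  invertible (phi ⋆ idm (f ∘ k)) <-> invertible ((phi ⋆ idm f) ⋆ idm k).
Proof.
  split; intros H.
  - replace ((phi ⋆ idm f) ⋆ idm k) with
      (bwd (assoc g' f k) • ((phi ⋆ idm (f ∘ k)) • assoc g f k)).
    + apply invertible_cmp; [exact (iso_invertible ((assoc g' f k)^-1))|].
      apply invertible_cmp; [exact H | apply iso_invertible].
    + now rewrite <- hcomp_id, <- assoc_nat, bwd_fwd_pre.
  - replace (phi ⋆ idm (f ∘ k)) with
      (assoc g' f k • (((phi ⋆ idm f) ⋆ idm k) • bwd (assoc g f k))).
    + apply invertible_cmp; [apply iso_invertible|].
      apply invertible_cmp; [exact H | exact (iso_invertible ((assoc g f k)^-1))].
    + now rewrite <- cmp_assoc, assoc_nat, cmp_assoc, fwd_bwd, cmp_idr, hcomp_id.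
Qed.
End OneMorphisms.

(** * Inverters as a factorization property *)

Section InverterCharacterization.
Variables (D : Bicategory) (X1 X2 : D) (f1 f2 : hom X1 X2) (phi : mor f1 f2).

(** Since [InvCone] is a full subcategory, its morphisms and isomorphisms are those of [hom W X1].
    Full faithfulness is thus a statement about [postcomp W ft] alone, and essential surjectivity
    says that every cone factors through [ft]. *)
Lemma is_inverter_iff (Xt : D) (ft : hom Xt X1) :
  is_inverter phi ft <->
  invertible (phi ⋆ idm ft) /\
  (forall W, fully_faithful_functor (postcomp W ft)) /\
  (forall W (k : hom W X1), invertible (phi ⋆ idm k) -> exists l, ft ∘ l ≅ k).
Proof.
  split.
  - intros [cone H]; split; [exact cone | split].
    + intros W; exact (proj1 (equivalence_weak (H W))).
    + intros W k Hk.
      destruct (proj2 (equivalence_weak (H W)) (exist _ k Hk)) as [l [i]].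
      exists l; constructor; exact (@Build_Iso (hom W X1) _ _ (fwd i) (bwd i) (bwd_fwd i) (fwd_bwd i)).
  - intros [cone [H1 H2]]; exists cone; intros W.
    apply weak_equivalence_is_equivalence; split.
    + exact (H1 W).
    + intros [k Hk]; destruct (H2 W k Hk) as [l [i]]; exists l; constructor.
      exact (@Build_Iso (InvCone phi W) (inverter_functor cone W l) (exist _ k Hk)
               (fwd i) (bwd i) (bwd_fwd i) (fwd_bwd i)).
Qed.
End InverterCharacterization.

Section PseudofunctorIso.
Variables (A B : Bicategory) (F G : Pseudofunctor A B).

Lemma pseudofunctor_comp1 X Y Z (g : @hom A Y Z) (f : hom X Y) :
  F ·₁ (g ∘ f) ≅ F ·₁ g ∘ F ·₁ f.
Proof. exact (inhabits ((pcomp F g f)^-1)). Qed.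

Lemma pseudofunctor_id1 X : F ·₁ (id1 X) ≅ id1 (F X).
Proof. exact (inhabits ((pid F X)^-1)). Qed.

Lemma transformation_square (s : Transformation F G) X Y (f : @hom A X Y) :
  G ·₁ f ∘ s X ≅ s Y ∘ F ·₁ f.
Proof. exact (inhabits (tnat s f)). Qed.

Lemma pseudofunctor_equivalence X Y (f : @hom A X Y) :
  is_equivalence f -> is_equivalence (F ·₁ f).
Proof.
  intros [g [Hgf Hfg]]; exists (F ·₁ g).
  split; match goal with |- inhabited (Iso ?x ?y) => change (x ≅ y) end.
  - rewrite <- pseudofunctor_comp1, <- pseudofunctor_id1.
    change (g ∘ f ≅ id1 X) in Hgf; now rewrite Hgf.
  - rewrite <- pseudofunctor_comp1, <- pseudofunctor_id1.
    change (f ∘ g ≅ id1 Y) in Hfg; now rewrite Hfg.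
Qed.
End PseudofunctorIso.

(** Naturality of a long composite of isomorphisms is proved by peeling off one factor at a time
    with this lemma; [b] is the value of the functor at the intermediate stage. *)
Lemma square_cmp (C : Category) (x y z x' y' z' : C) (i : mor x y) (j : mor y z)
  (i' : mor x' y') (j' : mor y' z') (a : mor x x') (b : mor y y') (c : mor z z') :
  j' • b = c • j -> i' • a = b • i -> (j' • i') • a = c • (j • i).
Proof. intros H1 H2; now rewrite cmp_assoc, H2, <- cmp_assoc, H1, cmp_assoc. Qed.

Lemma is_equivalence_id1 (B : Bicategory) (X : B) : is_equivalence (id1 X).
Proof. exists (id1 X); split; exact (inhabits (lunit (id1 X))). Qed.

Lemma in_essential_image_ob (B C : Bicategory) (G : Pseudofunctor B C) (Y : B) :
  in_essential_image G (G Y).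
Proof. exists Y, (id1 (G Y)); apply is_equivalence_id1. Qed.

(** * Hom-equivalences of a biadjunction *)

Section HomEquivalence.
Variables (A C : Bicategory) (N : Pseudofunctor C A) (H : Pseudofunctor A C)
  (adj : Biadjunction N H).

Notation η := (biadj_unit adj).
Notation ε := (biadj_counit adj).

Lemma left_triangle X : ε (N X) ∘ N ·₁ (η X) ≅ id1 (N X).
Proof.
  destruct (invertible_iso (biadj_left_inv adj X)) as [i _]; exact (inhabits i).
Qed.

Definition transpose X Y : Functor (hom (N X) Y) (hom X (H Y)) :=
  functor_comp (precomp (H Y) (η X)) (ploc H (N X) Y).

Definition cotranspose X Y : Functor (hom X (H Y)) (hom (N X) Y) :=
  functor_comp (postcomp (N X) (ε Y)) (ploc N X (H Y)).

(** Naturality of [ε] along [k] turns [ε ∘ N (H k) ∘ N η] into [k ∘ ε ∘ N η], and the left triangle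
    isomorphism [t] cancels the tail. As [t] is given by a mere existence statement while a [NatIso]
    is data, it is extracted by choice. *)
Lemma cotranspose_transpose X Y :
  NatIso (functor_comp (cotranspose X Y) (transpose X Y)) (functor_id (hom (N X) Y)).
Proof.
  destruct (constructive_indefinite_description _ (invertible_iso (biadj_left_inv adj X))) as [t _].
  unshelve refine (@Build_NatIso _ _ (functor_comp (cotranspose X Y) (transpose X Y)) (functor_id _)
    (fun k : hom (N X) Y =>
      iso_cmp (runit k) (iso_cmp (lwhisker_iso k t) (iso_cmp (assoc k (ε (N X)) (N ·₁ η X))
     (iso_cmp (rwhisker_iso ((tnat ε k)^-1) (N ·₁ η X))
     (iso_cmp ((assoc (ε Y) _ (N ·₁ η X))^-1)
              (lwhisker_iso (ε Y) ((pcomp N (H ·₁ k) (η X))^-1))))))) _).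
  intros k k' a; cbn.
  refine (square_cmp (runit_nat a) _).
  refine (square_cmp (eq_sym (hcomp_lr _ _)) _).
  refine (square_cmp (assoc_nat_l _ _ a) _).
  refine (square_cmp (b := (idm (ε Y) ⋆ N ·₂ (H ·₂ a)) ⋆ idm (N ·₁ η X)) _ _).
  { rewrite <- !hcomp_cmp_r; f_equal; symmetry; apply iso_conj; exact (tnat_nat ε a). }
  refine (square_cmp (b := idm (ε Y) ⋆ (N ·₂ (H ·₂ a) ⋆ idm (N ·₁ η X))) _ _).
  { apply assoc_inv_nat. }
  rewrite <- !hcomp_cmp_l; f_equal; symmetry; apply iso_conj; apply pcomp_nat_r.
Qed.

Lemma transpose_cotranspose X Y :
  NatIso (functor_comp (transpose X Y) (cotranspose X Y)) (functor_id (hom X (H Y))).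
Proof.
  destruct (constructive_indefinite_description _ (invertible_iso (biadj_right_inv adj Y))) as [t _].
  unshelve refine (@Build_NatIso _ _ (functor_comp (transpose X Y) (cotranspose X Y)) (functor_id _)
    (fun f : hom X (H Y) =>
      iso_cmp (lunit f) (iso_cmp (rwhisker_iso t f)
     (iso_cmp ((assoc (H ·₁ ε Y) (η (H Y)) f)^-1)
     (iso_cmp (lwhisker_iso (H ·₁ ε Y) (tnat η f))
     (iso_cmp (assoc (H ·₁ ε Y) (H ·₁ (N ·₁ f)) (η X))
              (rwhisker_iso ((pcomp H (ε Y) (N ·₁ f))^-1) (η X))))))) _).
  intros f f' a; cbn.
  refine (square_cmp (lunit_nat a) _).
  refine (square_cmp (hcomp_lr _ _) _).
  refine (square_cmp (eq_sym (iso_conj (assoc_nat_r _ _ a))) _).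
  refine (square_cmp (b := idm (H ·₁ ε Y) ⋆ (H ·₂ (N ·₂ a) ⋆ idm (η X))) _ _).
  { rewrite <- !hcomp_cmp_l; f_equal; exact (tnat_nat η a). }
  refine (square_cmp (b := (idm (H ·₁ ε Y) ⋆ H ·₂ (N ·₂ a)) ⋆ idm (η X)) _ _).
  { apply assoc_nat. }
  rewrite <- !hcomp_cmp_r; f_equal; symmetry; apply iso_conj; apply pcomp_nat_l.
Qed.

Lemma transpose_weak_equivalence X Y : weak_equivalence (transpose X Y).
Proof.
  apply equivalence_weak; exists (cotranspose X Y); split; constructor.
  - apply cotranspose_transpose.
  - apply transpose_cotranspose.
Qed.

(* [transpose] turns precomposition with [N e] into precomposition with [e]. *)
Lemma precomp_weak_equivalence X E (e : hom X E) (Y : A) :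
  is_equivalence (N ·₁ e) -> weak_equivalence (precomp (H Y) e).
Proof.
  intros He.
  apply (weak_equivalence_cancel_r (transpose_weak_equivalence E Y)).
  apply weak_equivalence_natiso with (F := functor_comp (transpose X Y) (precomp Y (N ·₁ e)));
    [| exact (weak_equivalence_comp (transpose_weak_equivalence X Y) (equivalence_precomp Y He))].
  unshelve refine (@Build_NatIso _ _ (functor_comp (transpose X Y) (precomp Y (N ·₁ e)))
    (functor_comp (precomp (H Y) e) (transpose E Y))
    (fun k : hom (N E) Y =>
      iso_cmp ((assoc (H ·₁ k) (η E) e)^-1)
     (iso_cmp (lwhisker_iso (H ·₁ k) (tnat η e))
     (iso_cmp (assoc (H ·₁ k) (H ·₁ (N ·₁ e)) (η X))
              (rwhisker_iso ((pcomp H k (N ·₁ e))^-1) (η X))))) _).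
  intros k k' a; cbn.
  refine (square_cmp (eq_sym (iso_conj (assoc_nat_l _ _ (H ·₂ a)))) _).
  refine (square_cmp (b := H ·₂ a ⋆ idm (H ·₁ (N ·₁ e) ∘ η X)) _ _).
  { symmetry; exact (hcomp_lr (H ·₂ a) (tnat η e)). }
  refine (square_cmp (assoc_nat_l _ _ (H ·₂ a)) _).
  rewrite <- !hcomp_cmp_r; f_equal; symmetry; apply iso_conj; apply pcomp_nat_r.
Qed.

Lemma transpose_reflects_isomorphic X Y (k l : hom (N X) Y) :
  H ·₁ k ∘ η X ≅ H ·₁ l ∘ η X -> k ≅ l.
Proof. exact (fully_faithful_reflects_isomorphic (proj1 (transpose_weak_equivalence X Y))). Qed.

End HomEquivalence.

(** * The reflection [X -> M' X] *)

Section Reflection.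
Variables (A C : Bicategory) (H : Pseudofunctor A C) (N : Pseudofunctor C A)
  (adj : Biadjunction N H).

Notation HN := (pseudofunctor_comp H N).
Notation Ψ := (biadj_unit adj).
(* The components of unit and counit at the unfolded types, on which rewriting depends. *)
Let ψ X : hom X (H (N X)) := Ψ X.
Let ε Y : hom (N (H Y)) Y := biadj_counit adj Y.

Variables (μ : Modification (unit_prewhisker Ψ HN) (unit_postwhisker HN Ψ))
  (M' : C -> C) (Λ : forall X : C, hom (M' X) (H (N X)))
  (Λ_inverter : forall X : C, is_inverter (μ X) (Λ X))
  (μΨ_inv : invertible_modification (modification_rwhisker μ Ψ))
  (HNΛ_pseudomonic : forall X : C, pseudomonic (H ·₁ (N ·₁ Λ X))).

Lemma exists_reflection_unit X : exists e : hom X (M' X), Λ X ∘ e ≅ Ψ X.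
Proof. exact (proj2 (proj2 (proj1 (is_inverter_iff _ _) (Λ_inverter X))) X (Ψ X) (μΨ_inv X)). Qed.

Section Unit.
Variables (X : C) (e : hom X (M' X)) (Λe : Λ X ∘ e ≅ ψ X).

(** The isomorphism is the cell [μ X ⋆ idm (Λ X)] itself: the two sides are its source and
    target. *)
Lemma inverter_fork : ψ (H (N X)) ∘ Λ X ≅ H ·₁ (N ·₁ (ψ X)) ∘ Λ X.
Proof.
  destruct (invertible_iso (proj1 (proj1 (is_inverter_iff _ _) (Λ_inverter X)))) as [i _].
  exact (inhabits i).
Qed.

Lemma ψ_square U V (f : @hom C U V) : H ·₁ (N ·₁ f) ∘ ψ U ≅ ψ V ∘ f.
Proof. exact (transformation_square Ψ f). Qed.

Lemma ε_square U V (f : @hom A U V) : f ∘ ε U ≅ ε V ∘ N ·₁ (H ·₁ f).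
Proof. exact (transformation_square (biadj_counit adj) f). Qed.

Lemma ε_ψ U : ε (N U) ∘ N ·₁ (ψ U) ≅ id1 (N U).
Proof. apply left_triangle. Qed.

(** The form in which the pseudomonicity hypothesis is applied. *)
Lemma HNΛ_reflects W (k l : hom W (H (N (M' X)))) :
  H ·₁ (N ·₁ Λ X) ∘ k ≅ H ·₁ (N ·₁ Λ X) ∘ l -> k ≅ l.
Proof. exact (pseudomonic_reflects_isomorphic (HNΛ_pseudomonic X W) (x := k) (y := l)). Qed.

(** The transpose of [Λ X] under the biadjunction. *)
Let r : hom (N (M' X)) (N X) := ε (N X) ∘ N ·₁ (Λ X).

Lemma retraction_section : r ∘ N ·₁ e ≅ id1 (N X).
Proof. unfold r; rewrite comp1_assoc, <- pseudofunctor_comp1, Λe; apply ε_ψ. Qed.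

(** Composition with [HN Λ] turns the two sides into the two legs of [inverter_fork]: the left one
    by naturality of [ψ] along [Λ X], the right one because [Λ X ∘ e ≅ ψ X]. *)
Lemma unit_Λ : ψ (M' X) ≅ H ·₁ (N ·₁ e) ∘ Λ X.
Proof.
  apply HNΛ_reflects.
  rewrite <- comp1_assoc, <- !pseudofunctor_comp1, Λe, ψ_square; exact inverter_fork.
Qed.

(** Composition with [HN Λ] makes the left side the image under [H] of [N ψ ∘ ε ∘ N Λ]. Naturality
    moves [ε] to the front, the fork exchanges [HN ψ] for [ψ] at [HN X], and the left triangle
    leaves [N Λ]. *)
Lemma HN_section_retraction : H ·₁ (N ·₁ e) ∘ H ·₁ r ≅ id1 (H (N (M' X))).
Proof.
  apply HNΛ_reflects; unfold r.
  rewrite <- comp1_assoc, <- !pseudofunctor_comp1, Λe, comp1_idr.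
  rewrite <- comp1_assoc, ε_square, comp1_assoc, <- pseudofunctor_comp1.
  rewrite <- inverter_fork, (pseudofunctor_comp1 N), <- (comp1_assoc (ε _)), ε_ψ.
  now rewrite comp1_idl.
Qed.

Lemma unit_equivalence : is_equivalence (N ·₁ e).
Proof.
  exists r; split; [exact retraction_section|].
  apply (transpose_reflects_isomorphic (adj := adj)).
  (* The two images under [H] agree even before they are composed with the unit. *)
  apply comp1_isomorphic; [|reflexivity].
  rewrite pseudofunctor_comp1, pseudofunctor_id1; exact HN_section_retraction.
Qed.

Lemma precomp_unit_weak_equivalence Y : weak_equivalence (precomp (H Y) e).
Proof. exact (precomp_weak_equivalence adj Y unit_equivalence). Qed.

Lemma HN_unit_equivalence : is_equivalence (H ·₁ (N ·₁ e)).
Proof. exact (pseudofunctor_equivalence H unit_equivalence). Qed.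

(* The modification axiom of [μ] at [e], conjugated by the equivalence [HN (HN e)]. *)
Lemma invertible_transport W (k : hom W (H (N X))) :
  invertible (μ (M' X) ⋆ idm (H ·₁ (N ·₁ e) ∘ k)) <-> invertible (μ X ⋆ idm k).
Proof.
  rewrite invertible_whisker_comp.
  set (v := H ·₁ (N ·₁ (H ·₁ (N ·₁ e)))).
  pose (n1 := rwhisker_iso (tnat (unit_prewhisker Ψ HN) e) k).
  pose (n2 := rwhisker_iso (tnat (unit_postwhisker HN Ψ) e) k).
  pose proof (mnat μ e) as E; cbn [unit_prewhisker] in E.
  transitivity (invertible ((idm v ⋆ μ X) ⋆ idm k)).
  - symmetry; apply (invertible_iff_conj (i := n1) (j := n2)); cbn [n1 n2 rwhisker_iso hcomp_iso fwd iso_id].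
    rewrite <- !hcomp_cmp, !cmp_idl; f_equal; symmetry; exact E.
  - transitivity (invertible (idm v ⋆ (μ X ⋆ idm k))).
    + eapply invertible_iff_conj; apply assoc_nat.
    + assert (Hv : is_equivalence v) by (do 2 apply pseudofunctor_equivalence; exact HN_unit_equivalence).
      split.
      * exact (fully_faithful_reflects_invertible (F := postcomp W v) (proj1 (equivalence_postcomp W Hv))).
      * intros Hi; destruct (invertible_iso Hi) as [i <-].
        exact (iso_invertible (lwhisker_iso v i)).
Qed.

Lemma reflection_is_inverter : is_inverter (μ (M' X)) (Ψ (M' X)).
Proof.
  destruct (proj1 (is_inverter_iff _ _) (Λ_inverter X)) as [H1 [H2 H3]].
  apply is_inverter_iff; split; [|split].
  - apply (invertible_whisker_iso (f := H ·₁ (N ·₁ e) ∘ Λ X)); [symmetry; exact unit_Λ|].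
    now apply invertible_transport.
  - intros W; destruct unit_Λ as [i].
    apply (fully_faithful_natiso (natiso_sym (postcomp_cast W i))).
    apply (fully_faithful_natiso (natiso_sym (postcomp_comp W _ _))).
    exact (fully_faithful_comp (proj1 (equivalence_postcomp W HN_unit_equivalence)) (H2 W)).
  - intros W k Hk.
    (* Since [HN e] is an equivalence, [k] lifts to some [k'] into [HN X]; by transport [k'] is a
       cone on [μ X] and so factors through [Λ X]. *)
    destruct (proj2 (equivalence_postcomp W HN_unit_equivalence) k) as [k' Hk']; cbn in Hk'.
    destruct (H3 W k') as [l Hl].
    + apply invertible_transport; refine (invertible_whisker_iso _ Hk); symmetry; exact Hk'.
    + exists l; change (ψ (M' X) ∘ l ≅ k); now rewrite unit_Λ, comp1_assoc, Hl.
Qed.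

Lemma precomp_unit_inverter Z :
  is_inverter (μ Z) (Ψ Z) -> weak_equivalence (precomp Z e).
Proof.
  intros HZ; destruct (proj1 (is_inverter_iff _ _) HZ) as [_ [H2 H3]].
  split.
  - apply (fully_faithful_cancel_l (H2 X)), (fully_faithful_natiso (precomp_postcomp (Ψ Z) e)).
    exact (fully_faithful_comp (proj1 (precomp_unit_weak_equivalence (N Z))) (H2 (M' X))).
  - intros f.
    (* [ψ Z ∘ f] takes values in an object [H Y], so it extends along [e] to some [k], which will be
       factored through [Ψ Z]. *)
    destruct (proj2 (precomp_unit_weak_equivalence (N Z)) (ψ Z ∘ f)) as [k Hk]; cbn in Hk.
    destruct (H3 (M' X) k) as [l Hl].
    (* The codomain of [μ Z] also has the form [H Y], so invertibility of [μ Z ⋆ idm k] may be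
       tested after precomposition with [e], where [k ∘ e ≅ ψ Z ∘ f] inherits the cone condition
       from [ψ Z]. *)
    + apply (fully_faithful_reflects_invertible (proj1 (precomp_unit_weak_equivalence (N (H (N Z)))))).
      apply invertible_whisker_comp.
      apply (invertible_whisker_iso (f := ψ Z ∘ f)); [symmetry; exact Hk|].
      apply invertible_whisker_comp.
      exact (invertible_rwhisker f (proj1 (proj1 (is_inverter_iff _ _) HZ))).
    + exists l; apply (fully_faithful_reflects_isomorphic (H2 X)); cbn.
      change (ψ Z ∘ l ≅ k) in Hl; change (ψ Z ∘ (l ∘ e) ≅ ψ Z ∘ f).
      now rewrite <- comp1_assoc, Hl.
Qed.
End Unit.
End Reflection.

(** * Whiskered pasting *)

Notation "g ◁ a" := (hcomp (idm g) a) (at level 38, left associativity) : bicat_scope.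
Notation "b ▷ f" := (hcomp b (idm f)) (at level 38, left associativity) : bicat_scope.

Lemma cmp_pre3 (C : Category) (x y z t : C) (c : mor z t) (b : mor y z) (a : mor x y) d :
  c • (b • a) = d -> forall w (r : mor w x), c • (b • (a • r)) = d • r.
Proof. now intros <- w r; rewrite !cmp_assoc. Qed.

Lemma cmp_pre4 (C : Category) (x y z t s : C) (e : mor t s) (c : mor z t) (b : mor y z) (a : mor x y) d :
  e • (c • (b • a)) = d -> forall w (r : mor w x), e • (c • (b • (a • r))) = d • r.
Proof. now intros <- w r; rewrite !cmp_assoc. Qed.

(* Rewriting with an equation between composites inside a longer composite associated to the right. *)
Ltac rewrite_in_composite E :=
  first [ rewrite E | rewrite (cmp_pre E) | rewrite (cmp_pre3 E) | rewrite (cmp_pre4 E) ];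
  rewrite ?cmp_assoc.
Tactic Notation "rw" uconstr(E) := rewrite_in_composite E.
Tactic Notation "rw" "<-" uconstr(E) := rewrite_in_composite (eq_sym E).

Lemma rwhisker_eq (B : Bicategory) (W X Y : B) (g g' : hom X Y) (a b : mor g g') :
  a = b -> forall f : hom W X, a ▷ f = b ▷ f.
Proof. now intros ->. Qed.

Lemma lwhisker_eq (B : Bicategory) (X Y Z : B) (f f' : hom X Y) (a b : mor f f') :
  a = b -> forall g : hom Y Z, g ◁ a = g ◁ b.
Proof. now intros ->. Qed.

(** Goals keep whiskering distributed over vertical composites; an equation has to be whiskered and
    distributed in the same way before it can match. *)
Ltac rewrite_rwhiskered E f :=
  let H := fresh in pose proof (rwhisker_eq E f) as H;
  rewrite ?hcomp_cmp_r, ?cmp_assoc in H; rewrite_in_composite H; clear H.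
Ltac rewrite_lwhiskered g E :=
  let H := fresh in pose proof (lwhisker_eq E g) as H;
  rewrite ?hcomp_cmp_l, ?cmp_assoc in H; rewrite_in_composite H; clear H.
Tactic Notation "rwr" constr(E) "at" constr(f) := rewrite_rwhiskered E f.
Tactic Notation "rwl" constr(E) "at" constr(g) := rewrite_lwhiskered g E.

Section Whiskering.
Variable B : Bicategory.
Implicit Types V W X Y Z : B.

Lemma whisker_exchange X Y Z (g g' : hom Y Z) (f f' : hom X Y) (b : mor g g') (a : mor f f') :
  b ⋆ a = (g' ◁ a) • (b ▷ f).
Proof. now rewrite <- hcomp_cmp, cmp_idl, cmp_idr. Qed.

Lemma lwhisker_bwd_fwd X Y Z (g : hom Y Z) (f f' : hom X Y) (i : Iso f f') :
  (g ◁ bwd i) • (g ◁ fwd i) = idm _.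
Proof. now rewrite <- hcomp_cmp_l, bwd_fwd, hcomp_id. Qed.

Lemma lwhisker_fwd_bwd X Y Z (g : hom Y Z) (f f' : hom X Y) (i : Iso f f') :
  (g ◁ fwd i) • (g ◁ bwd i) = idm _.
Proof. now rewrite <- hcomp_cmp_l, fwd_bwd, hcomp_id. Qed.

Lemma rwhisker_fwd_bwd X Y Z (g g' : hom Y Z) (f : hom X Y) (i : Iso g g') :
  (fwd i ▷ f) • (bwd i ▷ f) = idm _.
Proof. now rewrite <- hcomp_cmp_r, fwd_bwd, hcomp_id. Qed.

Lemma assoc_nat_m W X Y Z (h : hom Y Z) (g g' : hom X Y) (f : hom W X) (b : mor g g') :
  assoc h g' f • ((h ◁ b) ▷ f) = (h ◁ (b ▷ f)) • assoc h g f.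
Proof. apply assoc_nat. Qed.

Lemma assoc_inv_nat_l W X Y Z (h h' : hom Y Z) (g : hom X Y) (f : hom W X) (c : mor h h') :
  bwd (assoc h' g f) • (c ▷ (g ∘ f)) = ((c ▷ g) ▷ f) • bwd (assoc h g f).
Proof. symmetry; apply iso_conj, assoc_nat_l. Qed.

Lemma assoc_inv_nat_m W X Y Z (h : hom Y Z) (g g' : hom X Y) (f : hom W X) (b : mor g g') :
  bwd (assoc h g' f) • (h ◁ (b ▷ f)) = ((h ◁ b) ▷ f) • bwd (assoc h g f).
Proof. apply assoc_inv_nat. Qed.

Lemma assoc_inv_nat_r W X Y Z (h : hom Y Z) (g : hom X Y) (f f' : hom W X) (a : mor f f') :
  bwd (assoc h g f') • (h ◁ (g ◁ a)) = ((h ∘ g) ◁ a) • bwd (assoc h g f).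
Proof. symmetry; apply iso_conj, assoc_nat_r. Qed.

Lemma lunit_inv_nat X Y (f f' : hom X Y) (a : mor f f') :
  bwd (lunit f') • a = (id1 Y ◁ a) • bwd (lunit f).
Proof. symmetry; apply iso_conj, lunit_nat. Qed.

Lemma assoc_lunit_inv X Y Z (g : hom Y Z) (f : hom X Y) :
  bwd (assoc (id1 Z) g f) • bwd (lunit (g ∘ f)) = bwd (lunit g) ▷ f.
Proof.
  apply (iso_mono (i := rwhisker_iso (lunit g) f)); cbn.
  rewrite rwhisker_fwd_bwd, <- lunit_comp, cmp_assoc, fwd_bwd_pre; apply fwd_bwd.
Qed.

Lemma triangle_inv X Y Z (g : hom Y Z) (f : hom X Y) :
  (runit g ▷ f) • (bwd (assoc g (id1 Y) f) • (g ◁ bwd (lunit f))) = idm _.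
Proof. now rewrite <- triangle, cmp_assoc, fwd_bwd_pre, lwhisker_fwd_bwd. Qed.

Lemma pentagon_inv V W X Y Z (k : hom Y Z) (h : hom X Y) (g : hom W X) (f : hom V W) :
  (assoc k h g ▷ f) • (bwd (assoc (k ∘ h) g f) • bwd (assoc k h (g ∘ f))) =
  bwd (assoc k (h ∘ g) f) • (k ◁ bwd (assoc h g f)).
Proof.
  rewrite <- cmp_assoc, pentagon_3, !cmp_assoc, fwd_bwd, cmp_idr; reflexivity.
Qed.

Definition assoc3 V W X Y Z (q : @hom B Y Z) (t : hom X Y) (y : hom W X) (x : hom V W) :
  Iso ((q ∘ (t ∘ y)) ∘ x) (q ∘ (t ∘ (y ∘ x))) :=
  iso_cmp (lwhisker_iso q (assoc t y x)) (assoc q (t ∘ y) x).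

(** A triangular cell acting on [x]: whiskering, rebracketed so that the source is [s] applied to
    [u] applied to [x]. [sq] does the same for square cells. *)
Definition tri X Y Z (s : @hom B Y Z) (u : hom X Y) (t : hom X Z) (r : Iso (s ∘ u) t)
  W (x : hom W X) : Iso (s ∘ (u ∘ x)) (t ∘ x) :=
  iso_cmp (rwhisker_iso r x) ((assoc s u x)^-1).

Lemma tri_nat X Y Z (s : @hom B Y Z) (u : hom X Y) (t : hom X Z) (r : Iso (s ∘ u) t)
  W (x x' : hom W X) (ξ : mor x x') :
  tri r x' • (s ◁ (u ◁ ξ)) = (t ◁ ξ) • tri r x.
Proof. cbn; rewrite !cmp_assoc, assoc_inv_nat_r; rw (hcomp_lr _ _); reflexivity. Qed.

Lemma tri_comp X Y Z (s : @hom B Y Z) (u : hom X Y) (t : hom X Z) (r : Iso (s ∘ u) t)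
  V W (y : hom W X) (x : hom V W) :
  tri r (y ∘ x) • assoc3 s u y x = assoc t y x • (tri r y ▷ x).
Proof.
  cbn; rewrite hcomp_cmp_r, !cmp_assoc, pentagon_1, bwd_fwd_pre.
  now rw <- (assoc_nat_l y x (fwd r)).
Qed.

Lemma lwhisker_tri X Y Z Z' (q : @hom B Z Z') (s : hom Y Z) (u : hom X Y) (t : hom X Z)
  (r : Iso (s ∘ u) t) W (x : hom W X) :
  (q ◁ tri r x) • assoc3 q s u x = assoc q t x • ((q ◁ r) ▷ x).
Proof.
  cbn; rewrite hcomp_cmp_l, !cmp_assoc; rw (lwhisker_bwd_fwd _ _).
  now rewrite cmp_idl, assoc_nat_m.
Qed.

Definition sq X Y X' Y' (q : @hom B Y Y') (t : hom X Y) (t' : hom X' Y') (p : hom X X')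
  (n : Iso (q ∘ t) (t' ∘ p)) W (x : hom W X) : Iso (q ∘ (t ∘ x)) (t' ∘ (p ∘ x)) :=
  iso_cmp (assoc t' p x) (tri n x).

Section Squares.
Variables (X Y X' Y' : B) (q : hom Y Y') (t : hom X Y) (t' : hom X' Y') (p : hom X X')
  (n : Iso (q ∘ t) (t' ∘ p)).

Lemma sq_nat W (x x' : hom W X) (ξ : mor x x') :
  sq n x' • (q ◁ (t ◁ ξ)) = (t' ◁ (p ◁ ξ)) • sq n x.
Proof.
  unfold sq; cbn [fwd iso_cmp]; rewrite cmp_assoc, tri_nat; rw (assoc_nat_r _ _ _); reflexivity.
Qed.

Lemma sq_assoc W (x : hom W X) : sq n x • assoc q t x = assoc t' p x • (n ▷ x).
Proof. cbn; now rewrite !cmp_assoc, bwd_fwd, cmp_idr. Qed.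

Lemma sq_comp V W (y : hom W X) (x : hom V W) :
  sq n (y ∘ x) • assoc3 q t y x = assoc3 t' p y x • (sq n y ▷ x).
Proof.
  unfold sq; cbn [fwd iso_cmp assoc3]; rewrite hcomp_cmp_r, !cmp_assoc.
  pose proof (tri_comp n y x) as E; cbn [fwd iso_cmp assoc3] in E; rewrite E.
  rw (pentagon t' p y x); reflexivity.
Qed.

Lemma sq_id : (t' ◁ runit p) • sq n (id1 X) = n • (q ◁ runit t).
Proof.
  cbn; rewrite <- !cmp_assoc, runit_comp, runit_nat, !cmp_assoc; f_equal.
  now rewrite <- runit_comp, cmp_assoc, fwd_bwd, cmp_idr.
Qed.

Lemma sq_cell (q' : hom Y Y') (p' : hom X X') (n' : Iso (q' ∘ t) (t' ∘ p'))
  (a : mor q q') (b : mor p p') :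
  n' • (a ▷ t) = (t' ◁ b) • n ->
  forall W (x : hom W X), sq n' x • (a ▷ (t ∘ x)) = (t' ◁ (b ▷ x)) • sq n x.
Proof.
  intros E W x; cbn; rewrite !cmp_assoc, assoc_inv_nat_l; rw <- (hcomp_cmp_r x n' (a ▷ t)).
  rewrite E, hcomp_cmp_r, !cmp_assoc; rw (assoc_nat_m _ _ _); reflexivity.
Qed.

Lemma lwhisker_sq Z (z : hom Y' Z) W (x : hom W X) :
  (z ◁ sq n x) • assoc3 z q t x = assoc3 z t' p x • ((z ◁ n) ▷ x).
Proof.
  cbn [fwd iso_cmp assoc3 lwhisker_iso hcomp_iso iso_id].
  rewrite !cmp_assoc; rw <- (hcomp_cmp_l z (sq n x) (assoc q t x)).
  rewrite sq_assoc, hcomp_cmp_l, !cmp_assoc, assoc_nat_m; reflexivity.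
Qed.
End Squares.

Lemma assoc3_assoc_inv V W X Y Z (q : @hom B Y Z) (t : hom X Y) (y : hom W X) (x : hom V W) :
  bwd (assoc q t (y ∘ x)) • assoc3 q t y x = assoc (q ∘ t) y x • (bwd (assoc q t y) ▷ x).
Proof. cbn; now rewrite pentagon_1, bwd_fwd_pre. Qed.

(** The hypothesis has the shape of the composition axiom of a transformation. Precomposing with
    [assoc3] displays each factor of the conclusion as a cell whiskered by [x], where that axiom can
    be substituted. *)
Lemma sq_paste X0 X1 X2 Y0 Y1 Y2 (t0 : @hom B X0 Y0) (t1 : hom X1 Y1) (t2 : hom X2 Y2)
  (p1 : hom X0 X1) (p2 : hom X1 X2) (p3 : hom X0 X2)
  (q1 : hom Y0 Y1) (q2 : hom Y1 Y2) (q3 : hom Y0 Y2)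
  (n1 : Iso (q1 ∘ t0) (t1 ∘ p1)) (n2 : Iso (q2 ∘ t1) (t2 ∘ p2)) (n3 : Iso (q3 ∘ t0) (t2 ∘ p3))
  (γq : mor (q2 ∘ q1) q3) (γp : mor (p2 ∘ p1) p3) :
  n3 • ((γq ▷ t0) • bwd (assoc q2 q1 t0)) = (t2 ◁ γp) • (sq n2 p1 • (q2 ◁ n1)) ->
  forall W (x : hom W X0),
  sq n3 x • ((γq ▷ (t0 ∘ x)) • bwd (assoc q2 q1 (t0 ∘ x))) =
  (t2 ◁ ((γp ▷ x) • bwd (assoc p2 p1 x))) • (sq n2 (p1 ∘ x) • (q2 ◁ sq n1 x)).
Proof.
  intros E W x; apply (iso_epi (i := assoc3 q2 q1 t0 x)); rewrite !cmp_assoc.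
  rewrite lwhisker_sq, assoc3_assoc_inv; rw (sq_comp _ _ _).
  rw <- (assoc_nat_l t0 x γq); rw (sq_assoc _ _).
  rewrite <- !hcomp_cmp_r, E, !hcomp_cmp_r; rw (assoc_nat_m _ _ _).
  rewrite hcomp_cmp_l, !cmp_assoc; do 2 f_equal.
  cbn -[sq]; rewrite !cmp_assoc; rw (lwhisker_bwd_fwd _ _); now rewrite cmp_idl.
Qed.

Lemma sq_unit X Y (t : @hom B X Y) (p : hom X X) (q : hom Y Y) (n : Iso (q ∘ t) (t ∘ p))
  (ιq : mor (id1 Y) q) (ιp : mor (id1 X) p) :
  n • ((ιq ▷ t) • bwd (lunit t)) = (t ◁ ιp) • bwd (runit t) ->
  forall W (x : hom W X),
  sq n x • ((ιq ▷ (t ∘ x)) • bwd (lunit (t ∘ x))) = t ◁ ((ιp ▷ x) • bwd (lunit x)).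
Proof.
  intros E W x; cbn; rewrite !cmp_assoc; rw (assoc_inv_nat_l _ _ _); rw (assoc_lunit_inv _ _).
  rewrite <- !hcomp_cmp_r, E, hcomp_cmp_r; rw (assoc_nat_m _ _ _).
  rewrite hcomp_cmp_l; f_equal.
  apply (iso_mono (i := lwhisker_iso t (lunit x))); cbn.
  rewrite lwhisker_fwd_bwd, <- cmp_assoc, triangle; apply rwhisker_fwd_bwd.
Qed.
End Whiskering.

(* [A] acts through [P] on the hom-categories [hom W (P X)], by [f · x = P f ∘ x]. Expanding whiskered
   cells along this action removes the associators of [C] from all pasting equations. *)
Section Action.
Variables (A C : Bicategory) (P : Pseudofunctor A C).

Definition act_comp X Y Z (g : @hom A Y Z) (f : hom X Y) W (x : hom W (P X)) :
  Iso (P ·₁ g ∘ (P ·₁ f ∘ x)) (P ·₁ (g ∘ f) ∘ x) := tri (pcomp P g f) x.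

Definition act_id X W (x : hom W (P X)) : Iso x (P ·₁ (id1 X) ∘ x) :=
  iso_cmp (rwhisker_iso (pid P X) x) ((lunit x)^-1).

Lemma act_comp_nat X Y Z (g g' : @hom A Y Z) (f f' : hom X Y) W (x : hom W (P X))
  (b : mor g g') (a : mor f f') :
  act_comp g' f' x • (P ·₂ b ⋆ (P ·₂ a ▷ x)) = (P ·₂ (b ⋆ a) ▷ x) • act_comp g f x.
Proof.
  cbn; rewrite !cmp_assoc, assoc_inv_nat; rw <- (hcomp_cmp_r x (pcomp P g' f') (P ·₂ b ⋆ P ·₂ a)).
  now rewrite <- pcomp_nat, hcomp_cmp_r, cmp_assoc.
Qed.

Lemma act_comp_nat_l X Y Z (g g' : @hom A Y Z) (f : hom X Y) W (x : hom W (P X)) (b : mor g g') :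
  act_comp g' f x • (P ·₂ b ▷ (P ·₁ f ∘ x)) = (P ·₂ (b ▷ f) ▷ x) • act_comp g f x.
Proof. rewrite <- act_comp_nat, fmor_id, hcomp_id; reflexivity. Qed.

Lemma act_comp_nat_r X Y Z (g : @hom A Y Z) (f f' : hom X Y) W (x : hom W (P X)) (a : mor f f') :
  act_comp g f' x • (P ·₁ g ◁ (P ·₂ a ▷ x)) = (P ·₂ (g ◁ a) ▷ x) • act_comp g f x.
Proof. rewrite <- act_comp_nat, fmor_id; reflexivity. Qed.

Lemma act_comp_nat_x X Y Z (g : @hom A Y Z) (f : hom X Y) W (x x' : hom W (P X)) (ξ : mor x x') :
  act_comp g f x' • (P ·₁ g ◁ (P ·₁ f ◁ ξ)) = (P ·₁ (g ∘ f) ◁ ξ) • act_comp g f x.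
Proof. apply tri_nat. Qed.

Lemma act_id_nat X W (x x' : hom W (P X)) (ξ : mor x x') :
  act_id x' • ξ = (P ·₁ (id1 X) ◁ ξ) • act_id x.
Proof. cbn; rewrite !cmp_assoc, lunit_inv_nat; rw (hcomp_lr _ _); reflexivity. Qed.

(** This is [pcomp_assoc] whiskered by [x]. The pentagon absorbs the associators of [C], and only
    the image of the associator of [A] remains. *)
Lemma act_assoc X Y Z Z' (h : @hom A Z Z') (g : hom Y Z) (f : hom X Y) W (x : hom W (P X)) :
  (P ·₂ assoc h g f ▷ x) • (act_comp (h ∘ g) f x • act_comp h g (P ·₁ f ∘ x)) =
  act_comp h (g ∘ f) x • (P ·₁ h ◁ act_comp g f x).
Proof.
  cbn; rewrite hcomp_cmp_l, !cmp_assoc.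
  rw (assoc_inv_nat_l _ _ _); rw (assoc_inv_nat_m _ _ _).
  rwr (pcomp_assoc P h g f) at x; do 2 f_equal; apply pentagon_inv.
Qed.

Lemma act_assoc_bwd X Y Z Z' (h : @hom A Z Z') (g : hom Y Z) (f : hom X Y) W (x : hom W (P X)) :
  (P ·₂ bwd (assoc h g f) ▷ x) • (act_comp h (g ∘ f) x • (P ·₁ h ◁ act_comp g f x)) =
  act_comp (h ∘ g) f x • act_comp h g (P ·₁ f ∘ x).
Proof.
  rewrite <- act_assoc, <- cmp_assoc, <- hcomp_cmp_r, <- fmor_cmp, bwd_fwd, fmor_id, hcomp_id.
  apply cmp_idl.
Qed.

Lemma act_lunit X Y (f : @hom A X Y) W (x : hom W (P X)) :
  (P ·₂ lunit f ▷ x) • (act_comp (id1 Y) f x • act_id (P ·₁ f ∘ x)) = idm _.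
Proof.
  cbn; rewrite !cmp_assoc; rw (assoc_inv_nat_l _ _ _); rw (assoc_lunit_inv _ _).
  rwr (pid_l P f) at x; apply rwhisker_fwd_bwd.
Qed.

Lemma act_lunit_inv X Y (f : @hom A X Y) W (x : hom W (P X)) :
  act_id (P ·₁ f ∘ x) • ((P ·₂ lunit f ▷ x) • act_comp (id1 Y) f x) = idm _.
Proof.
  apply (iso_epi (i := act_id (P ·₁ f ∘ x))).
  now rewrite !cmp_assoc, act_lunit, cmp_idl, cmp_idr.
Qed.

Lemma act_runit X Y (f : @hom A X Y) W (x : hom W (P X)) :
  (P ·₂ runit f ▷ x) • (act_comp f (id1 X) x • (P ·₁ f ◁ act_id x)) = idm _.
Proof.
  cbn; rewrite hcomp_cmp_l, !cmp_assoc; rw (assoc_inv_nat_m _ _ _).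
  rwr (pid_r P f) at x; apply triangle_inv.
Qed.

Lemma act_comp_comp X Y Z (g : @hom A Y Z) (f : hom X Y) V W (y : hom W (P X)) (x : hom V W) :
  act_comp g f (y ∘ x) • assoc3 (P ·₁ g) (P ·₁ f) y x = assoc (P ·₁ (g ∘ f)) y x • (act_comp g f y ▷ x).
Proof. apply tri_comp. Qed.
End Action.
Arguments act_comp {_ _} P {_ _ _} g f {_} x.
Arguments act_id {_ _} P {_ _} x.

(** * Composition and unit axioms of squares in action form *)

Section SquaresInImage.
Variables (B C : Bicategory) (G : Pseudofunctor B C).

Lemma sq_act_paste (X0 X1 X2 : C) (Z0 Z1 Z2 : B)
  (u0 : hom X0 (G Z0)) (u1 : hom X1 (G Z1)) (u2 : hom X2 (G Z2))
  (p1 : hom X0 X1) (p2 : hom X1 X2) (p3 : hom X0 X2)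
  (k1 : hom Z0 Z1) (k2 : hom Z1 Z2) (k3 : hom Z0 Z2)
  (n1 : Iso (G ·₁ k1 ∘ u0) (u1 ∘ p1)) (n2 : Iso (G ·₁ k2 ∘ u1) (u2 ∘ p2))
  (n3 : Iso (G ·₁ k3 ∘ u0) (u2 ∘ p3)) (γk : mor (k2 ∘ k1) k3) (γp : Iso (p2 ∘ p1) p3) :
  n3 • ((G ·₂ γk ▷ u0) • act_comp G k2 k1 u0) = (u2 ◁ γp) • (sq n2 p1 • (G ·₁ k2 ◁ n1)) ->
  forall W (x : hom W X0),
  sq n3 x • ((G ·₂ γk ▷ (u0 ∘ x)) • act_comp G k2 k1 (u0 ∘ x)) =
  (u2 ◁ tri γp x) • (sq n2 (p1 ∘ x) • (G ·₁ k2 ◁ sq n1 x)).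
Proof.
  intros E W x; cbn [act_comp tri fwd iso_cmp iso_inv rwhisker_iso hcomp_iso iso_id].
  rewrite <- (cmp_assoc (_ ▷ _) (_ ▷ _)), <- hcomp_cmp_r.
  apply (@sq_paste C); rewrite <- E.
  cbn [act_comp tri fwd iso_cmp iso_inv rwhisker_iso hcomp_iso iso_id].
  now rewrite hcomp_cmp_r, cmp_assoc.
Qed.

Lemma sq_act_unit (X : C) (Z : B) (u : hom X (G Z)) (p : hom X X) (k : hom Z Z)
  (n : Iso (G ·₁ k ∘ u) (u ∘ p)) (ιk : mor (id1 Z) k) (ιp : mor (id1 X) p) :
  n • ((G ·₂ ιk ▷ u) • act_id G u) = (u ◁ ιp) • bwd (runit u) ->
  forall W (x : hom W X),
  sq n x • ((G ·₂ ιk ▷ (u ∘ x)) • act_id G (u ∘ x)) = u ◁ ((ιp ▷ x) • bwd (lunit x)).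
Proof.
  intros E W x; cbn [act_id fwd iso_cmp iso_inv rwhisker_iso hcomp_iso iso_id].
  rewrite <- (cmp_assoc (_ ▷ _) (_ ▷ _)), <- hcomp_cmp_r.
  apply (@sq_unit C); rewrite <- E.
  cbn [act_id fwd iso_cmp iso_inv rwhisker_iso hcomp_iso iso_id].
  now rewrite hcomp_cmp_r, cmp_assoc.
Qed.
End SquaresInImage.

(** * Universal arrows *)

Section UniversalArrow.
Variables (B C : Bicategory) (G : Pseudofunctor B C) (X : C) (Z : B) (u : hom X (G Z)).

(** A bicategorical universal arrow from [X] to [G]. Faithfulness, fullness and essential
    surjectivity are exactly the uniqueness of cells, the lifting of cells and the factorization of
    1-morphisms used below. *)
Definition universal_arrow : Prop :=
  forall Y : B, weak_equivalence (functor_comp (precomp (G Y) u) (ploc G Z Y)).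

Hypothesis u_universal : universal_arrow.

Lemma universal_faithful Y (k k' : hom Z Y) (a b : mor k k') :
  G ·₂ a ▷ u = G ·₂ b ▷ u -> a = b.
Proof. exact (proj1 (proj1 (u_universal Y)) k k' a b). Qed.

Lemma universal_lift Y (k k' : hom Z Y) (c : mor (G ·₁ k ∘ u) (G ·₁ k' ∘ u)) :
  {a : mor k k' | G ·₂ a ▷ u = c}.
Proof.
  apply constructive_indefinite_description; exact (proj2 (proj1 (u_universal Y)) k k' c).
Qed.

Lemma universal_lift_iso Y (k k' : hom Z Y) (c : Iso (G ·₁ k ∘ u) (G ·₁ k' ∘ u)) :
  {a : Iso k k' | G ·₂ a ▷ u = c}.
Proof.
  destruct (universal_lift (fwd c)) as [a Ha], (universal_lift (bwd c)) as [b Hb].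
  assert (E1 : b • a = idm k).
  { apply universal_faithful.
    now rewrite fmor_cmp, hcomp_cmp_r, Ha, Hb, bwd_fwd, fmor_id, hcomp_id. }
  assert (E2 : a • b = idm k').
  { apply universal_faithful.
    now rewrite fmor_cmp, hcomp_cmp_r, Ha, Hb, fwd_bwd, fmor_id, hcomp_id. }
  now exists (Build_Iso E1 E2).
Qed.

Lemma universal_factor Y (f : hom X (G Y)) : {k : hom Z Y & Iso (G ·₁ k ∘ u) f}.
Proof.
  destruct (constructive_indefinite_description _ (proj2 (u_universal Y) f)) as [k Hk].
  exists k; destruct (constructive_indefinite_description (fun _ : Iso (G ·₁ k ∘ u) f => True)) as [i _].
  - destruct Hk as [i]; now exists i.
  - exact i.
Qed.
End UniversalArrow.

(** * The pseudofunctor assembled from universal arrows, relative to [P] *)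

Section FromUniversalArrows.
Variables (A B C : Bicategory) (P : Pseudofunctor A C) (G : Pseudofunctor B C)
  (M : A -> B) (u : forall X : A, hom (P X) (G (M X)))
  (u_universal : forall X : A, universal_arrow (u X)).

Definition lift1 X Y (f : @hom A X Y) : hom (M X) (M Y) :=
  projT1 (universal_factor (u_universal X) (u Y ∘ P ·₁ f)).

Definition lift_nat X Y (f : @hom A X Y) : Iso (G ·₁ lift1 f ∘ u X) (u Y ∘ P ·₁ f) :=
  projT2 (universal_factor (u_universal X) (u Y ∘ P ·₁ f)).

Definition lift2 X Y (f f' : @hom A X Y) (a : mor f f') : mor (lift1 f) (lift1 f') :=
  proj1_sig (universal_lift (u_universal X) (bwd (lift_nat f') • ((u Y ◁ P ·₂ a) • lift_nat f))).

Lemma lift2_spec X Y (f f' : @hom A X Y) (a : mor f f') :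
  lift_nat f' • (G ·₂ lift2 a ▷ u X) = (u Y ◁ P ·₂ a) • lift_nat f.
Proof. unfold lift2; now rewrite (proj2_sig (universal_lift _ _)), fwd_bwd_pre. Qed.

Definition lift_functor X Y : Functor (hom X Y) (hom (M X) (M Y)).
Proof.
  refine {| fob := @lift1 X Y; fmor := @lift2 X Y |}.
  - intros f; apply (universal_faithful (u_universal X)), (iso_mono (i := lift_nat f)).
    now rewrite lift2_spec, !fmor_id, !hcomp_id, cmp_idl, cmp_idr.
  - intros f f' f'' b a; apply (universal_faithful (u_universal X)), (iso_mono (i := lift_nat f'')).
    rewrite lift2_spec, !fmor_cmp, hcomp_cmp_r, hcomp_cmp_l; rw (lift2_spec b).
    now rewrite lift2_spec.
Defined.

(** The lifted cell is the one forced by requiring [lift_nat] to satisfy the composition axiom of a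
    transformation, recorded in [lift_comp_spec]. [lift_id] arises in the same way from the unit
    axiom. *)
Definition lift_comp X Y Z (g : @hom A Y Z) (f : hom X Y) :
  Iso (lift1 g ∘ lift1 f) (lift1 (g ∘ f)) :=
  proj1_sig (universal_lift_iso (u_universal X)
    (iso_cmp ((lift_nat (g ∘ f))^-1)
    (iso_cmp (lwhisker_iso (u Z) (pcomp P g f))
    (iso_cmp (sq (lift_nat g) (P ·₁ f))
    (iso_cmp (lwhisker_iso (G ·₁ lift1 g) (lift_nat f))
             ((act_comp G (lift1 g) (lift1 f) (u X))^-1)))))).

Lemma lift_comp_spec X Y Z (g : @hom A Y Z) (f : hom X Y) :
  lift_nat (g ∘ f) • ((G ·₂ lift_comp g f ▷ u X) • act_comp G (lift1 g) (lift1 f) (u X)) =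
  (u Z ◁ pcomp P g f) • (sq (lift_nat g) (P ·₁ f) • (G ·₁ lift1 g ◁ lift_nat f)).
Proof.
  unfold lift_comp; rewrite (proj2_sig (universal_lift_iso _ _)).
  cbn [fwd iso_cmp iso_inv lwhisker_iso hcomp_iso iso_id].
  now rewrite !cmp_assoc, fwd_bwd_pre, bwd_fwd, cmp_idr.
Qed.

Lemma lift_comp_act X Y Z (g : @hom A Y Z) (f : hom X Y) W (x : hom W (P X)) :
  sq (lift_nat (g ∘ f)) x • ((G ·₂ lift_comp g f ▷ (u X ∘ x)) • act_comp G (lift1 g) (lift1 f) (u X ∘ x)) =
  (u Z ◁ act_comp P g f x) • (sq (lift_nat g) (P ·₁ f ∘ x) • (G ·₁ lift1 g ◁ sq (lift_nat f) x)).
Proof.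
  apply (sq_act_paste (lift_comp_spec g f)).
Qed.

Definition lift_id X : Iso (id1 (M X)) (lift1 (id1 X)) :=
  proj1_sig (universal_lift_iso (u_universal X)
    (iso_cmp ((lift_nat (id1 X))^-1)
    (iso_cmp (lwhisker_iso (u X) (pid P X))
    (iso_cmp ((runit (u X))^-1) ((act_id G (u X))^-1))))).

Lemma lift_id_spec X :
  lift_nat (id1 X) • ((G ·₂ lift_id X ▷ u X) • act_id G (u X)) = (u X ◁ pid P X) • bwd (runit (u X)).
Proof.
  unfold lift_id; rewrite (proj2_sig (universal_lift_iso _ _)).
  cbn [fwd iso_cmp iso_inv lwhisker_iso hcomp_iso iso_id].
  now rewrite !cmp_assoc, fwd_bwd_pre, bwd_fwd, cmp_idr.
Qed.

Lemma lift_id_act X W (x : hom W (P X)) :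
  sq (lift_nat (id1 X)) x • ((G ·₂ lift_id X ▷ (u X ∘ x)) • act_id G (u X ∘ x)) = u X ◁ act_id P x.
Proof.
  apply (sq_act_unit (lift_id_spec X)).
Qed.

(** Each equation is placed between [lift_nat] and the action isomorphisms of [G]. The
    specifications then trade every lifted cell for the cell of [P] beneath it, which leaves the
    corresponding axiom of [P]. *)
Definition lift_pseudofunctor : Pseudofunctor A B.
Proof.
  refine (@Build_Pseudofunctor A B M lift_functor lift_comp lift_id _ _ _ _).
  - intros X Y Z g g' f f' b a; cbn [fob fmor lift_functor].
    apply (universal_faithful (u_universal X)), (iso_mono (i := lift_nat (g' ∘ f'))).
    apply (iso_epi (i := act_comp G (lift1 g) (lift1 f) (u X))).
    rewrite !fmor_cmp, !hcomp_cmp_r, !cmp_assoc; rw (lift2_spec _).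
    rewrite lift_comp_spec, <- act_comp_nat; rw (lift_comp_spec g' f').
    rewrite <- hcomp_cmp, lift2_spec, cmp_idl.
    rewrite <- (cmp_idr (G ·₂ lift2 b)), hcomp_cmp.
    rewrite (whisker_exchange (G ·₂ lift2 b)), !cmp_assoc.
    rw (sq_nat _ _).
    rw (sq_cell (lift2_spec b) (P ·₁ f)).
    rwl (pcomp_nat P b a) at (u Z); rewrite (whisker_exchange (P ·₂ b)).
    now rewrite hcomp_cmp_l, !cmp_assoc.
  - intros W X Y Z h g f; cbn [fob fmor lift_functor].
    apply (universal_faithful (u_universal W)), (iso_mono (i := lift_nat (h ∘ (g ∘ f)))).
    apply (iso_epi (i := iso_cmp (act_comp G (lift1 h ∘ lift1 g) (lift1 f) (u W))
                                 (act_comp G (lift1 h) (lift1 g) (G ·₁ lift1 f ∘ u W)))).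
    cbn [fwd iso_cmp].
    rewrite !fmor_cmp, !hcomp_cmp_r, !cmp_assoc; rw (lift2_spec _).
    rw <- (act_comp_nat_l (lift1 f) (u W) (lift_comp h g)); rw (lift_comp_spec (h ∘ g) f).
    rw <- (hcomp_lr (G ·₂ lift_comp h g) (lift_nat f)).
    rw <- (act_comp_nat_x (P := G) (lift1 h) (lift1 g) (lift_nat f)).
    rw (lift_comp_act h g (P ·₁ f)).
    rw (act_assoc (P := G) (lift1 h) (lift1 g) (lift1 f) (u W)).
    rw <- (act_comp_nat_r (P := G) (lift1 h) (u W) (lift_comp g f)).
    rw (lift_comp_spec h (g ∘ f)).
    rewrite <- !hcomp_cmp_l, lift_comp_spec, !hcomp_cmp_l.
    rw (sq_nat (lift_nat h) (pcomp P g f)).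
    cbn [act_comp tri fwd iso_cmp iso_inv rwhisker_iso hcomp_iso iso_id].
    rewrite hcomp_cmp_l, !cmp_assoc; rwl (pcomp_assoc P h g f) at (u Z).
    rw (lwhisker_fwd_bwd _ _); now rewrite cmp_idl.
  - intros X Y f; cbn [fob fmor lift_functor].
    apply (universal_faithful (u_universal X)), (iso_mono (i := lift_nat f)).
    apply (iso_epi (i := iso_cmp (act_comp G (id1 (M Y)) (lift1 f) (u X))
                                 (act_id G (G ·₁ lift1 f ∘ u X)))).
    cbn [fwd iso_cmp].
    rewrite !cmp_assoc, act_lunit, cmp_idr.
    rewrite !fmor_cmp, !hcomp_cmp_r, !cmp_assoc; rw (lift2_spec _).
    rw <- (act_comp_nat_l (lift1 f) (u X) (lift_id Y)); rw (lift_comp_spec (id1 Y) f).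
    rw <- (hcomp_lr (G ·₂ lift_id Y) (lift_nat f)); rewrite <- act_id_nat.
    rw (lift_id_act (P ·₁ f)).
    cbn [act_id fwd iso_cmp iso_inv rwhisker_iso hcomp_iso iso_id].
    rewrite hcomp_cmp_l, !cmp_assoc; rwl (pid_l P f) at (u Y).
    rw (lwhisker_fwd_bwd _ _); now rewrite cmp_idl.
  - intros X Y f; cbn [fob fmor lift_functor].
    apply (universal_faithful (u_universal X)), (iso_mono (i := lift_nat f)).
    apply (iso_epi (i := iso_cmp (act_comp G (lift1 f) (id1 (M X)) (u X))
                                 (lwhisker_iso (G ·₁ lift1 f) (act_id G (u X))))).
    cbn [fwd iso_cmp lwhisker_iso hcomp_iso iso_id].
    rewrite !cmp_assoc, act_runit, cmp_idr.
    rewrite !fmor_cmp, !hcomp_cmp_r, !cmp_assoc; rw (lift2_spec _).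
    rw <- (act_comp_nat_r (P := G) (lift1 f) (u X) (lift_id X)); rw (lift_comp_spec f (id1 X)).
    rewrite <- !hcomp_cmp_l, lift_id_spec, !hcomp_cmp_l.
    rw (sq_nat (lift_nat f) (pid P X)); rwl (pid_r P f) at (u Y).
    rw (sq_id (lift_nat f)); rewrite lwhisker_fwd_bwd, cmp_idr; reflexivity.
Defined.

(** The axioms are the specifications of the lifted cells, up to rebracketing. *)
Definition lift_transformation : Transformation P (pseudofunctor_comp G lift_pseudofunctor).
Proof.
  refine (@Build_Transformation A C P (pseudofunctor_comp G lift_pseudofunctor) u (@lift_nat) _ _ _).
  - intros X Y f f' a; apply lift2_spec.
  - intros X.
    apply (iso_epi (i := (lunit (u X))^-1)).
    cbn [pid pseudofunctor_comp lift_pseudofunctor fwd iso_cmp iso_inv functor_iso].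
    rewrite !cmp_assoc, fwd_bwd, cmp_idr, <- lift_id_spec, hcomp_cmp_r, cmp_assoc; reflexivity.
  - intros X Y Z g f.
    apply (iso_epi (i := (assoc (G ·₁ lift1 g) (G ·₁ lift1 f) (u X))^-1)).
    cbn [pcomp pseudofunctor_comp lift_pseudofunctor fwd iso_cmp iso_inv functor_iso].
    rewrite !cmp_assoc; cbn [ploc fob functor_comp lift_functor]; rewrite fwd_bwd, cmp_idr.
    rewrite hcomp_cmp_r, !cmp_assoc.
    pose proof (lift_comp_spec g f) as E; cbn -[lift_comp] in E; rewrite !cmp_assoc in E; exact E.
Defined.
End FromUniversalArrows.

(** * Transformation axioms tested under a pseudofunctor *)

Section ImageSquare.
Variables (B C : Bicategory) (G : Pseudofunctor B C).

Definition image_sq X Y X' Y' (q : @hom B Y Y') (t : hom X Y) (t' : hom X' Y') (p : hom X X')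
  (n : Iso (q ∘ t) (t' ∘ p)) : Iso (G ·₁ q ∘ G ·₁ t) (G ·₁ t' ∘ G ·₁ p) :=
  iso_cmp ((pcomp G t' p)^-1) (iso_cmp (functor_iso (ploc G _ _) n) (pcomp G q t)).

Definition act_sq X Y X' Y' (q : @hom B Y Y') (t : hom X Y) (t' : hom X' Y') (p : hom X X')
  (n : Iso (q ∘ t) (t' ∘ p)) W (x : hom W (G X)) :
  Iso (G ·₁ q ∘ (G ·₁ t ∘ x)) (G ·₁ t' ∘ (G ·₁ p ∘ x)) := sq (image_sq n) x.

Section Squares.
Variables (X Y X' Y' : B) (q : hom Y Y') (t : hom X Y) (t' : hom X' Y') (p : hom X X')
  (n : Iso (q ∘ t) (t' ∘ p)).

Lemma act_sq_spec W (x : hom W (G X)) :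
  act_comp G t' p x • act_sq n x = (G ·₂ n ▷ x) • act_comp G q t x.
Proof.
  cbn; rewrite !hcomp_cmp_r, !cmp_assoc, bwd_fwd_pre; rw (rwhisker_fwd_bwd _ _).
  now rewrite cmp_idl.
Qed.

Lemma act_sq_nat W (x x' : hom W (G X)) (ξ : mor x x') :
  act_sq n x' • (G ·₁ q ◁ (G ·₁ t ◁ ξ)) = (G ·₁ t' ◁ (G ·₁ p ◁ ξ)) • act_sq n x.
Proof. apply sq_nat. Qed.
End Squares.

End ImageSquare.

Section ImagePasting.
Variables (A B C : Bicategory) (G : Pseudofunctor B C) (Q M : Pseudofunctor A B)
  (s : forall X : A, hom (M X) (Q X))
  (δ : forall (X Y : A) (f : hom X Y), Iso (Q ·₁ f ∘ s X) (s Y ∘ M ·₁ f)).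

(** Reduces the composition axiom for [δ], read under [G] and whiskered by [x], to an equation free
    of associators: those of [B] are absorbed by [act_assoc] and its inverse form. *)
Lemma image_tnat_comp X Y Z (g : @hom A Y Z) (f : hom X Y) W (x : hom W (G (M X))) :
  act_sq (G := G) (δ (g ∘ f)) x •
    ((G ·₂ pcomp Q g f ▷ (G ·₁ s X ∘ x)) • act_comp G (Q ·₁ g) (Q ·₁ f) (G ·₁ s X ∘ x)) =
    (G ·₁ s Z ◁ ((G ·₂ pcomp M g f ▷ x) • act_comp G (M ·₁ g) (M ·₁ f) x)) •
    (act_sq (G := G) (δ g) (G ·₁ (M ·₁ f) ∘ x) • (G ·₁ (Q ·₁ g) ◁ act_sq (δ f) x)) ->
  G ·₂ (δ (g ∘ f) • (pcomp Q g f ▷ s X)) ▷ x =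
  G ·₂ ((s Z ◁ pcomp M g f) • (assoc _ _ _ • ((δ g ▷ M ·₁ f) •
        (bwd (assoc _ _ _) • ((Q ·₁ g ◁ δ f) • assoc _ _ _))))) ▷ x.
Proof.
  intros E.
  apply (iso_epi (i := iso_cmp (act_comp G (Q ·₁ g ∘ Q ·₁ f) (s X) x)
                               (act_comp G (Q ·₁ g) (Q ·₁ f) (G ·₁ s X ∘ x)))).
  cbn [fwd iso_cmp]; rewrite !fmor_cmp, !hcomp_cmp_r, !cmp_assoc.
  rw <- (act_comp_nat_l (P := G) (s X) x (pcomp Q g f)).
  rw <- (act_sq_spec (G := G) (δ (g ∘ f)) x); rewrite E.
  rewrite !hcomp_cmp_l, !cmp_assoc.
  rw (act_comp_nat_r (P := G) (s Z) x (pcomp M g f)).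
  f_equal.
  rw (act_assoc (P := G) (Q ·₁ g) (Q ·₁ f) (s X) x).
  rw <- (act_comp_nat_r (P := G) (Q ·₁ g) x (δ f)).
  rewrite <- hcomp_cmp_l, <- (act_sq_spec (G := G) (δ f) x), hcomp_cmp_l.
  rw (act_assoc_bwd (P := G) (Q ·₁ g) (s Y) (M ·₁ f) x).
  rw <- (act_comp_nat_l (P := G) (M ·₁ f) x (δ g)).
  rw <- (act_sq_spec (G := G) (δ g) (G ·₁ (M ·₁ f) ∘ x)).
  rw (act_assoc (P := G) (s Z) (M ·₁ g) (M ·₁ f) x).
  reflexivity.
Qed.

Lemma image_tnat_id X W (x : hom W (G (M X))) :
  act_sq (G := G) (δ (id1 X)) x • ((G ·₂ pid Q X ▷ (G ·₁ s X ∘ x)) • act_id G (G ·₁ s X ∘ x)) =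
    G ·₁ s X ◁ ((G ·₂ pid M X ▷ x) • act_id G x) ->
  G ·₂ (δ (id1 X) • (pid Q X ▷ s X)) ▷ x =
  G ·₂ ((s X ◁ pid M X) • (bwd (runit (s X)) • lunit (s X))) ▷ x.
Proof.
  intros E.
  apply (iso_epi (i := iso_cmp (act_comp G (id1 (Q X)) (s X) x) (act_id G (G ·₁ s X ∘ x)))).
  cbn [fwd iso_cmp]; rewrite !fmor_cmp, !hcomp_cmp_r, !cmp_assoc, act_lunit, cmp_idr.
  rw <- (act_comp_nat_l (P := G) (s X) x (pid Q X)).
  rw <- (act_sq_spec (G := G) (δ (id1 X)) x); rewrite E.
  rewrite !hcomp_cmp_l; rw (act_comp_nat_r (P := G) (s X) x (pid M X)); f_equal.
  apply (iso_mono (i := rwhisker_iso (functor_iso (ploc G _ _) (runit (s X))) x)).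
  cbn [fwd rwhisker_iso hcomp_iso functor_iso iso_id].
  rewrite act_runit, <- hcomp_cmp_r, <- fmor_cmp, fwd_bwd, fmor_id, hcomp_id; reflexivity.
Qed.

Lemma image_tnat_nat X Y (f f' : @hom A X Y) (a : mor f f') W (x : hom W (G (M X))) :
  act_sq (G := G) (δ f') x • (G ·₂ (Q ·₂ a) ▷ (G ·₁ s X ∘ x)) =
    (G ·₁ s Y ◁ (G ·₂ (M ·₂ a) ▷ x)) • act_sq (δ f) x ->
  G ·₂ (δ f' • (Q ·₂ a ▷ s X)) ▷ x = G ·₂ ((s Y ◁ M ·₂ a) • δ f) ▷ x.
Proof.
  intros E; apply (iso_epi (i := act_comp G (Q ·₁ f) (s X) x)).
  rewrite !fmor_cmp, !hcomp_cmp_r, !cmp_assoc.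
  rw <- (act_comp_nat_l (P := G) (s X) x (Q ·₂ a)).
  rw <- (act_sq_spec (G := G) (δ f') x); rewrite E.
  rw (act_comp_nat_r (P := G) (s Y) x (M ·₂ a)).
  now rewrite act_sq_spec.
Qed.
End ImagePasting.

(* The data of [u] at types in which the composite [G ∘ M] is unfolded: leaving the unfolding to
   unification makes conversion diverge in practice. *)
Section IntoComposite.
Variables (A B C : Bicategory) (P : Pseudofunctor A C) (G : Pseudofunctor B C)
  (M : Pseudofunctor A B) (u : Transformation P (pseudofunctor_comp G M)).

Definition composite_tob X : hom (P X) (G (M X)) := u X.
Definition composite_tnat X Y (f : @hom A X Y) :
  Iso (G ·₁ (M ·₁ f) ∘ composite_tob X) (composite_tob Y ∘ P ·₁ f) := tnat u f.
Definition composite_act X Y (f : @hom A X Y) W (x : hom W (P X)) :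
  Iso (G ·₁ (M ·₁ f) ∘ (composite_tob X ∘ x)) (composite_tob Y ∘ (P ·₁ f ∘ x)) := sq (composite_tnat f) x.

Lemma composite_act_cell X Y (f f' : @hom A X Y) (a : mor f f') W (x : hom W (P X)) :
  composite_act f' x • (G ·₂ (M ·₂ a) ▷ (composite_tob X ∘ x)) =
  (composite_tob Y ◁ (P ·₂ a ▷ x)) • composite_act f x.
Proof. apply (@sq_cell C); exact (tnat_nat u a). Qed.

Lemma composite_tnat_comp X Y Z (g : @hom A Y Z) (f : hom X Y) :
  composite_tnat (g ∘ f) •
    ((G ·₂ pcomp M g f ▷ composite_tob X) • act_comp G (M ·₁ g) (M ·₁ f) (composite_tob X)) =
  (composite_tob Z ◁ pcomp P g f) • (composite_act g (P ·₁ f) • (G ·₁ (M ·₁ g) ◁ composite_tnat f)).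
Proof.
  pose proof (tnat_comp u g f) as E.
  cbn [pcomp fwd pseudofunctor_comp iso_cmp functor_iso] in E; rewrite hcomp_cmp_r in E.
  apply (iso_epi (i := assoc (G ·₁ (M ·₁ g)) (G ·₁ (M ·₁ f)) (composite_tob X))).
  cbn [fwd act_comp composite_act sq tri iso_cmp iso_inv rwhisker_iso hcomp_iso iso_id].
  rewrite !cmp_assoc, bwd_fwd, cmp_idr; exact E.
Qed.

Lemma composite_act_comp X Y Z (g : @hom A Y Z) (f : hom X Y) W (x : hom W (P X)) :
  composite_act (g ∘ f) x •
    ((G ·₂ pcomp M g f ▷ (composite_tob X ∘ x)) • act_comp G (M ·₁ g) (M ·₁ f) (composite_tob X ∘ x)) =
  (composite_tob Z ◁ act_comp P g f x) •
    (composite_act g (P ·₁ f ∘ x) • (G ·₁ (M ·₁ g) ◁ composite_act f x)).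
Proof. exact (sq_act_paste (composite_tnat_comp g f) x). Qed.

Lemma composite_tnat_id X :
  composite_tnat (id1 X) • ((G ·₂ pid M X ▷ composite_tob X) • act_id G (composite_tob X)) =
  (composite_tob X ◁ pid P X) • bwd (runit (composite_tob X)).
Proof.
  pose proof (tnat_id u X) as E.
  cbn [pid fwd pseudofunctor_comp iso_cmp functor_iso] in E; rewrite hcomp_cmp_r in E.
  apply (iso_epi (i := lunit (composite_tob X))).
  cbn [fwd act_id iso_cmp iso_inv rwhisker_iso hcomp_iso iso_id].
  rewrite !cmp_assoc, bwd_fwd, cmp_idr; exact E.
Qed.

Lemma composite_act_id X W (x : hom W (P X)) :
  composite_act (id1 X) x • ((G ·₂ pid M X ▷ (composite_tob X ∘ x)) • act_id G (composite_tob X ∘ x)) =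
  composite_tob X ◁ act_id P x.
Proof. exact (sq_act_unit (composite_tnat_id X) x). Qed.
End IntoComposite.

(** * Factoring transformations through universal arrows *)

Section LiftTransformation.
Variables (A B C : Bicategory) (P : Pseudofunctor A C) (G : Pseudofunctor B C)
  (M : Pseudofunctor A B) (u : Transformation P (pseudofunctor_comp G M))
  (u_universal : forall X : A, universal_arrow (composite_tob u X))
  (Q : Pseudofunctor A B) (τ : Transformation P (pseudofunctor_comp G Q)).

Definition factor1 X : hom (M X) (Q X) := projT1 (universal_factor (u_universal X) (composite_tob τ X)).

Definition factor_iso X : Iso (G ·₁ factor1 X ∘ composite_tob u X) (composite_tob τ X) :=
  projT2 (universal_factor (u_universal X) (composite_tob τ X)).

(** The cell is determined by the demand that [factor_iso] be a modification, which is
    [factor_nat_spec]. *)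
Definition factor_nat X Y (f : @hom A X Y) : Iso (Q ·₁ f ∘ factor1 X) (factor1 Y ∘ M ·₁ f) :=
  proj1_sig (universal_lift_iso (u_universal X)
    (iso_cmp (act_comp G (factor1 Y) (M ·₁ f) (composite_tob u X))
    (iso_cmp ((lwhisker_iso (G ·₁ factor1 Y) (composite_tnat u f))^-1)
    (iso_cmp ((tri (factor_iso Y) (P ·₁ f))^-1)
    (iso_cmp (composite_tnat τ f)
    (iso_cmp (lwhisker_iso (G ·₁ (Q ·₁ f)) (factor_iso X))
             ((act_comp G (Q ·₁ f) (factor1 X) (composite_tob u X))^-1))))))).

Lemma factor_nat_spec X Y (f : @hom A X Y) :
  tri (factor_iso Y) (P ·₁ f) •
    ((G ·₁ factor1 Y ◁ composite_tnat u f) • act_sq (factor_nat f) (composite_tob u X)) =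
  composite_tnat τ f • (G ·₁ (Q ·₁ f) ◁ factor_iso X).
Proof.
  rewrite (fwd_to_bwd (act_sq_spec (factor_nat f) (composite_tob u X))).
  unfold factor_nat at 1; rewrite (proj2_sig (universal_lift_iso _ _)).
  cbn [fwd bwd iso_cmp iso_inv lwhisker_iso hcomp_iso iso_id].
  rewrite !cmp_assoc, bwd_fwd, cmp_idr, bwd_fwd_pre; rw (lwhisker_fwd_bwd _ _).
  now rewrite cmp_idl, fwd_bwd_pre.
Qed.

Lemma factor_nat_act X Y (f : @hom A X Y) W (x : hom W (P X)) :
  tri (factor_iso Y) (P ·₁ f ∘ x) •
    ((G ·₁ factor1 Y ◁ composite_act u f x) • act_sq (factor_nat f) (composite_tob u X ∘ x)) =
  composite_act τ f x • (G ·₁ (Q ·₁ f) ◁ tri (factor_iso X) x).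
Proof.
  apply (iso_epi (i := assoc3 (G ·₁ (Q ·₁ f)) (G ·₁ factor1 X) (composite_tob u X) x)).
  rewrite !cmp_assoc; unfold act_sq, composite_act.
  rewrite sq_comp; rw (lwhisker_sq _ _ _); rw (tri_comp _ _ _).
  pose proof (factor_nat_spec f) as E; unfold act_sq in E; rwr E at x.
  rewrite lwhisker_tri; rw (sq_assoc _ _); reflexivity.
Qed.

(** The instance [x := id1] suffices, by cancelling a unitor. Asking for every [x] puts the goal
    into the form of the action lemmas. *)
Lemma universal_faithful_act X Y (k k' : hom (M X) Y) (a b : mor k k') :
  (forall W (x : hom W (P X)), G ·₂ a ▷ (composite_tob u X ∘ x) = G ·₂ b ▷ (composite_tob u X ∘ x)) -> a = b.
Proof.
  intros E; apply (universal_faithful (u_universal X)), id1_rwhisker_inj.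
  apply (iso_mono (i := assoc (G ·₁ k') (composite_tob u X) (id1 (P X)))).
  rewrite !assoc_nat_l, (E _ (id1 (P X))); reflexivity.
Qed.

(** Through [factor_nat_act], each axiom follows from the same axiom for [u] and for [τ]. *)
Definition factor_transformation : Transformation M Q.
Proof.
  refine (@Build_Transformation A B M Q factor1 factor_nat _ _ _).
  - intros X Y f f' a; apply universal_faithful_act; intros W x; apply image_tnat_nat.
    apply (iso_mono (i := iso_cmp (tri (factor_iso Y) (P ·₁ f' ∘ x))
                                  (lwhisker_iso (G ·₁ factor1 Y) (composite_act u f' x)))).
    cbn [fwd iso_cmp lwhisker_iso hcomp_iso iso_id].
    rewrite !cmp_assoc; rw (factor_nat_act f' x).
    rw (eq_sym (hcomp_lr (G ·₂ (Q ·₂ a)) (tri (factor_iso X) x))).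
    rwl (composite_act_cell u a x) at (G ·₁ factor1 Y).
    rw (tri_nat (factor_iso Y) (P ·₂ a ▷ x)).
    rewrite factor_nat_act; rw (composite_act_cell τ a x); reflexivity.
  - intros X; apply universal_faithful_act; intros W x; apply image_tnat_id.
    apply (iso_mono (i := iso_cmp (tri (factor_iso X) (P ·₁ (id1 X) ∘ x))
                                  (lwhisker_iso (G ·₁ factor1 X) (composite_act u (id1 X) x)))).
    cbn [fwd iso_cmp lwhisker_iso hcomp_iso iso_id].
    rewrite !cmp_assoc; rw (factor_nat_act (id1 X) x).
    rw (eq_sym (hcomp_lr (G ·₂ pid Q X) (tri (factor_iso X) x))).
    rewrite <- act_id_nat; rw (composite_act_id τ x).
    rewrite hcomp_cmp_l; rwl (composite_act_id u x) at (G ·₁ factor1 X).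
    symmetry; apply tri_nat.
  - intros X Y Z g f; apply universal_faithful_act; intros W x; apply image_tnat_comp.
    apply (iso_mono (i := iso_cmp (tri (factor_iso Z) (P ·₁ (g ∘ f) ∘ x))
                                  (lwhisker_iso (G ·₁ factor1 Z) (composite_act u (g ∘ f) x)))).
    cbn [fwd iso_cmp lwhisker_iso hcomp_iso iso_id].
    rewrite !cmp_assoc; rw (factor_nat_act (g ∘ f) x).
    rw (eq_sym (hcomp_lr (G ·₂ pcomp Q g f) (tri (factor_iso X) x))).
    rewrite <- act_comp_nat_x; rw (composite_act_comp τ g f x).
    rewrite hcomp_cmp_l, !cmp_assoc.
    rwl (composite_act_comp u g f x) at (G ·₁ factor1 Z).
    rw (tri_nat (factor_iso Z) (act_comp P g f x)); f_equal.
    rw <- (act_sq_nat (factor_nat g) (composite_act u f x)).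
    rw (factor_nat_act g (P ·₁ f ∘ x)).
    now rewrite <- !hcomp_cmp_l, factor_nat_act.
Defined.
End LiftTransformation.

(** Allows the identity of [G] to be read as a transformation into [G ∘ 1], the shape required for
    factoring it. *)
Definition target_unitr_inv (A B : Bicategory) (F G : Pseudofunctor A B) (s : Transformation F G) :
  Transformation F (pseudofunctor_comp G (pseudofunctor_id A)).
Proof.
  refine (@Build_Transformation A B F (pseudofunctor_comp G (pseudofunctor_id A))
    (tob s) (fun X Y f => tnat s f) _ _ _); intros.
  - exact (tnat_nat s a).
  - cbn; rewrite fmor_id, cmp_idl; apply tnat_id.
  - cbn; rewrite fmor_id, cmp_idl; apply tnat_comp.
Defined.

Section VerticalPasting.
Variables (B C : Bicategory) (G : Pseudofunctor B C) (X X' Y Y' Z Z' : B)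
  (p : hom X X') (q : hom Y Y') (r : hom Z Z') (s : hom X Y) (s' : hom X' Y') (t : hom Y Z)
  (t' : hom Y' Z') (m : Iso (q ∘ s) (s' ∘ p)) (n : Iso (r ∘ t) (t' ∘ q)).

Definition sq_vcomp : Iso (r ∘ (t ∘ s)) ((t' ∘ s') ∘ p) :=
  iso_cmp ((assoc t' s' p)^-1)
 (iso_cmp (lwhisker_iso t' m)
 (iso_cmp (assoc t' q s)
 (iso_cmp (rwhisker_iso n s) ((assoc r t s)^-1)))).

Lemma act_sq_vcomp W (x : hom W (G X)) :
  act_sq sq_vcomp x • (G ·₁ r ◁ act_comp G t s x) =
  act_comp G t' s' (G ·₁ p ∘ x) • ((G ·₁ t' ◁ act_sq m x) • act_sq n (G ·₁ s ∘ x)).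
Proof.
  apply (iso_mono (i := act_comp G (t' ∘ s') p x)).
  rewrite <- !cmp_assoc, act_sq_spec, !cmp_assoc.
  cbn [sq_vcomp fwd iso_cmp iso_inv lwhisker_iso rwhisker_iso hcomp_iso iso_id].
  rewrite !fmor_cmp, !hcomp_cmp_r, !cmp_assoc.
  rewrite act_assoc_bwd; rw <- (act_comp_nat_l (P := G) s x n).
  rw <- (act_sq_spec n (G ·₁ s ∘ x)).
  rw (act_assoc (P := G) t' q s x).
  rw <- (act_comp_nat_r (P := G) t' x m).
  rwl (eq_sym (act_sq_spec m x)) at (G ·₁ t').
  rw (act_assoc_bwd (P := G) t' s' p x); reflexivity.
Qed.
End VerticalPasting.

Lemma tnat_transformation_comp (A B : Bicategory) (F G H : Pseudofunctor A B)
  (t : Transformation G H) (s : Transformation F G) X Y (f : @hom A X Y) :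
  tnat (transformation_comp t s) f = sq_vcomp (tnat s f) (tnat t f).
Proof. reflexivity. Qed.

Lemma tnat_postwhisker (A B C : Bicategory) (K : Pseudofunctor B C) (F G : Pseudofunctor A B)
  (s : Transformation F G) X Y (f : @hom A X Y) :
  tnat (postwhisker K s) f = image_sq K (tnat s f).
Proof. reflexivity. Qed.

(** * The biadjunction *)

Section BiadjunctionOfUniversalArrows.
Variables (B C : Bicategory) (G : Pseudofunctor B C) (M : Pseudofunctor C B)
  (U : Transformation (pseudofunctor_id C) (pseudofunctor_comp G M))
  (U_universal : forall X : C, universal_arrow (composite_tob U X)).

Notation UG := (target_assocr (unit_prewhisker U G)).
Notation idG := (target_unitr_inv (transformation_id G)).

Strategy 100 [factor1 factor_nat].

(** The factorization of the identity of [G] through [U] at [G]: here [P] is [G] and [Q] is the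
    identity of [B]. Its [factor_iso] is the right triangle isomorphism. *)
Definition universal_counit : Transformation (pseudofunctor_comp M G) (pseudofunctor_id B) :=
  factor_transformation (u := UG) (fun Y => U_universal (G Y)) idG.

Notation ε := universal_counit.

Definition counit1 Y : hom (M (G Y)) Y :=
  factor1 (u := UG) (fun Y => U_universal (G Y)) idG Y.
Definition counit_nat X Y (f : @hom B X Y) : Iso (f ∘ counit1 X) (counit1 Y ∘ M ·₁ (G ·₁ f)) :=
  factor_nat (u := UG) (fun Y => U_universal (G Y)) idG f.

Definition unit1 X : hom X (G (M X)) := composite_tob U X.
Definition unit_nat X Y (f : @hom C X Y) : Iso (G ·₁ (M ·₁ f) ∘ unit1 X) (unit1 Y ∘ f) := composite_tnat U f.

Definition counit_iso Y : Iso (G ·₁ counit1 Y ∘ unit1 (G Y)) (id1 (G Y)) :=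
  factor_iso (u := UG) (fun Y => U_universal (G Y)) idG Y.

Lemma counit_iso_nat X Y (f : @hom B X Y) :
  (counit_iso Y ▷ G ·₁ f) • sq_vcomp (unit_nat (G ·₁ f)) (image_sq G (counit_nat f)) =
  tnat (transformation_id G) f • (G ·₁ f ◁ counit_iso X).
Proof.
  refine (eq_trans _ (factor_nat_spec (u := UG) (fun Y => U_universal (G Y)) idG f)).
  cbn [act_sq sq sq_vcomp tri fwd iso_cmp iso_inv rwhisker_iso lwhisker_iso hcomp_iso iso_id].
  rewrite !cmp_assoc; reflexivity.
Qed.

Definition right_modification : Modification
  (transformation_comp (counit_postwhisker G ε) (target_assocr (unit_prewhisker U G)))
  (transformation_id G).
Proof.
  refine (@Build_Modification _ _ _ _
    (transformation_comp (counit_postwhisker G ε) (target_assocr (unit_prewhisker U G)))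
    (transformation_id G) (fun Y => fwd (counit_iso Y)) _).
  intros X Y f; exact (counit_iso_nat f).
Defined.

Definition act_counit Y W (x : hom W (G Y)) : Iso (G ·₁ counit1 Y ∘ (unit1 (G Y) ∘ x)) x :=
  iso_cmp (lunit x) (tri (counit_iso Y) x).

Lemma act_counit_nat Y W (x x' : hom W (G Y)) (ξ : mor x x') :
  act_counit x' • (G ·₁ counit1 Y ◁ (unit1 (G Y) ◁ ξ)) = ξ • act_counit x.
Proof.
  unfold act_counit; cbn [fwd iso_cmp]; rewrite !cmp_assoc, tri_nat.
  rw (lunit_nat ξ); reflexivity.
Qed.

Lemma act_counit_comp Y V W (y : hom W (G Y)) (x : hom V W) :
  act_counit (y ∘ x) • assoc3 (G ·₁ counit1 Y) (unit1 (G Y)) y x = act_counit y ▷ x.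
Proof.
  unfold act_counit; cbn [fwd iso_cmp]; rewrite !cmp_assoc, tri_comp; rw (lunit_comp y x).
  now rewrite hcomp_cmp_r.
Qed.

Lemma counit_nat_act Y Y' (g : @hom B Y Y') W (x : hom W (G Y)) :
  act_counit (G ·₁ g ∘ x) •
    ((G ·₁ counit1 Y' ◁ sq (unit_nat (G ·₁ g)) x) • act_sq (counit_nat g) (unit1 (G Y) ∘ x)) =
  G ·₁ g ◁ act_counit x.
Proof.
  pose proof (factor_nat_act (u := UG) (fun Y => U_universal (G Y)) idG g x) as E.
  (* The naturality cell of the identity transformation consists of unitors and disappears once the
     unit at its target is removed. *)
  assert (E2 : lunit (G ·₁ g ∘ x) •
    composite_act (M := pseudofunctor_id B) idG g x =
    G ·₁ g ◁ lunit x).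
  { unfold composite_act, composite_tnat, composite_tob.
    cbn [sq tri fwd iso_cmp iso_inv rwhisker_iso hcomp_iso iso_id tnat tob target_unitr_inv
      transformation_id pob ploc fob functor_comp pseudofunctor_comp functor_id pseudofunctor_id].
    rw (lunit_comp (G ·₁ g) x).
    rewrite hcomp_cmp_r, ?cmp_assoc; rw (rwhisker_fwd_bwd _ _); rewrite cmp_idl, <- triangle.
    now rewrite cmp_assoc, fwd_bwd, cmp_idr. }
  unfold act_counit; cbn [fwd iso_cmp]; rewrite hcomp_cmp_l, <- E2, !cmp_assoc.
  f_equal; exact E.
Qed.

Lemma unit_nat_cell X Y (f f' : @hom C X Y) (a : mor f f') :
  unit_nat f' • (G ·₂ (M ·₂ a) ▷ unit1 X) = (unit1 Y ◁ a) • unit_nat f.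
Proof. exact (tnat_nat U a). Qed.

Lemma unit_nat_comp X Y Z (g : @hom C Y Z) (f : hom X Y) :
  unit_nat (g ∘ f) • ((G ·₂ pcomp M g f ▷ unit1 X) • act_comp G (M ·₁ g) (M ·₁ f) (unit1 X)) =
  sq (unit_nat g) f • (G ·₁ (M ·₁ g) ◁ unit_nat f).
Proof.
  pose proof (composite_tnat_comp U g f) as E.
  change (fwd (pcomp (pseudofunctor_id C) g f)) with (idm (g ∘ f)) in E.
  rewrite hcomp_id, cmp_idl in E; exact E.
Qed.

(** The lifted cell combines naturality of the unit along the unit itself with the right triangle at
    [M X]. *)
Definition left_iso X : Iso (counit1 (M X) ∘ M ·₁ (unit1 X)) (id1 (M X)) :=
  proj1_sig (universal_lift_iso (U_universal X)
    (iso_cmp (act_id G (unit1 X))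
    (iso_cmp (act_counit (unit1 X))
    (iso_cmp (lwhisker_iso (G ·₁ counit1 (M X)) (unit_nat (unit1 X)))
             ((act_comp G (counit1 (M X)) (M ·₁ (unit1 X)) (unit1 X))^-1))))).

Lemma left_iso_spec X :
  (G ·₂ left_iso X ▷ unit1 X) • act_comp G (counit1 (M X)) (M ·₁ (unit1 X)) (unit1 X) =
  act_id G (unit1 X) • (act_counit (unit1 X) • (G ·₁ counit1 (M X) ◁ unit_nat (unit1 X))).
Proof.
  unfold left_iso; rewrite (proj2_sig (universal_lift_iso _ _)).
  cbn [fwd iso_cmp iso_inv lwhisker_iso hcomp_iso iso_id].
  now rewrite !cmp_assoc, bwd_fwd, cmp_idr.
Qed.

Lemma act_id_comp X V W (y : hom W (G X)) (x : hom V W) :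
  fwd (act_id G (y ∘ x)) = assoc _ y x • (act_id G y ▷ x).
Proof.
  cbn; rewrite hcomp_cmp_r, <- assoc_lunit_inv; rw (assoc_nat_l y x (pid G X)).
  now rewrite fwd_bwd_pre.
Qed.

Lemma left_iso_act X W (x : hom W X) :
  (G ·₂ left_iso X ▷ (unit1 X ∘ x)) • act_comp G (counit1 (M X)) (M ·₁ (unit1 X)) (unit1 X ∘ x) =
  act_id G (unit1 X ∘ x) • (act_counit (unit1 X ∘ x) • (G ·₁ counit1 (M X) ◁ sq (unit_nat (unit1 X)) x)).
Proof.
  apply (iso_epi (i := assoc3 (G ·₁ counit1 (M X)) (G ·₁ (M ·₁ (unit1 X))) (unit1 X) x)).
  rewrite !cmp_assoc, act_comp_comp, lwhisker_sq; rw (act_counit_comp _ _).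
  rw <- (assoc_nat_l (unit1 X) x (G ·₂ left_iso X)).
  rwr (left_iso_spec X) at x; rewrite act_id_comp, cmp_assoc; reflexivity.
Qed.

(** This is naturality of [U] with respect to the 2-morphism [unit_nat f], after [unit_nat_comp]
    expands the cells at its source and target. *)
Lemma unit_exchange X Y (f : @hom C X Y) :
  sq (unit_nat (unit1 Y)) f • ((G ·₁ (M ·₁ unit1 Y) ◁ unit_nat f) • act_sq (image_sq M (unit_nat f)) (unit1 X)) =
  (unit1 (G (M Y)) ◁ unit_nat f) •
    (sq (unit_nat (G ·₁ (M ·₁ f))) (unit1 X) • (G ·₁ (M ·₁ (G ·₁ (M ·₁ f))) ◁ unit_nat (unit1 X))).
Proof.
  rewrite <- unit_nat_comp, <- cmp_assoc, <- unit_nat_comp, !cmp_assoc, act_sq_spec.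
  cbn [image_sq fwd iso_cmp iso_inv functor_iso].
  rewrite !fmor_cmp, !hcomp_cmp_r, !cmp_assoc.
  rewrite <- (cmp_assoc (G ·₂ _ ▷ _) (G ·₂ bwd _ ▷ _)), <- hcomp_cmp_r, <- fmor_cmp, fwd_bwd.
  rewrite fmor_id, hcomp_id, cmp_idl; rw (unit_nat_cell (fwd (unit_nat f))); reflexivity.
Qed.

(** Under [G] and whiskered with the unit, [left_iso] becomes a right triangle isomorphism. The
    triangles at [X] and [Y] are linked by [unit_exchange] for the unit cells and by
    [counit_nat_act] for the counit cell. *)
Lemma left_iso_nat X Y (f : @hom C X Y) :
  (left_iso Y ▷ M ·₁ f) • sq_vcomp (image_sq M (unit_nat f)) (counit_nat (M ·₁ f)) =
  tnat (transformation_id M) f • (M ·₁ f ◁ left_iso X).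
Proof.
  change (fwd (tnat (transformation_id M) f)) with (bwd (lunit (M ·₁ f)) • runit (M ·₁ f)).
  apply (iso_mono (i := lunit (M ·₁ f))); rewrite !cmp_assoc, fwd_bwd_pre.
  apply (universal_faithful (U_universal X)); change (composite_tob U X) with (unit1 X).
  apply (iso_epi (i := iso_cmp (act_comp G (M ·₁ f) (counit1 (M X) ∘ M ·₁ unit1 X) (unit1 X))
    (lwhisker_iso (G ·₁ (M ·₁ f)) (act_comp G (counit1 (M X)) (M ·₁ unit1 X) (unit1 X))))).
  cbn [fwd iso_cmp lwhisker_iso hcomp_iso iso_id].
  rewrite !fmor_cmp, !hcomp_cmp_r, !cmp_assoc.
  rw <- (act_comp_nat_r (P := G) (M ·₁ f) (unit1 X) (left_iso X)).
  rewrite <- hcomp_cmp_l, left_iso_spec, hcomp_cmp_l, (cmp_pre3 (act_runit _ _)), cmp_idl.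
  rw <- (act_sq_spec (sq_vcomp (image_sq M (unit_nat f)) (counit_nat (M ·₁ f))) (unit1 X)).
  rewrite act_sq_vcomp.
  rw <- (act_comp_nat_l (P := G) (M ·₁ f) (unit1 X) (left_iso Y)).
  apply (iso_mono (i := iso_cmp (act_id G (unit1 Y ∘ f)) (unit_nat f))).
  cbn [fwd iso_cmp]; rewrite !cmp_assoc; rw (act_id_nat (P := G) (fwd (unit_nat f))).
  rw (act_lunit_inv (P := G) (M ·₁ f) (unit1 X)); rewrite cmp_idl.
  rw <- (hcomp_lr (G ·₂ left_iso Y) (unit_nat f)).
  rw <- (act_comp_nat_x (P := G) (counit1 (M Y)) (M ·₁ unit1 Y) (unit_nat f)).
  rw (left_iso_act f); f_equal.
  rwl (unit_exchange f) at (G ·₁ counit1 (M Y)).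
  rw (act_counit_nat (fwd (unit_nat f))); f_equal.
  rw <- (act_sq_nat (counit_nat (M ·₁ f)) (unit_nat (unit1 X))).
  rw (counit_nat_act (M ·₁ f) (unit1 X)); symmetry; apply hcomp_cmp_l.
Qed.

Definition left_modification : Modification
  (transformation_comp (counit_prewhisker ε M) (target_assocl (unit_postwhisker M U)))
  (transformation_id M).
Proof.
  refine (@Build_Modification _ _ _ _
    (transformation_comp (counit_prewhisker ε M) (target_assocl (unit_postwhisker M U)))
    (transformation_id M) (fun X => fwd (left_iso X)) _).
  intros X Y f; rewrite tnat_transformation_comp.
  change (tnat (target_assocl (unit_postwhisker M U)) f) with (tnat (postwhisker M U) f).
  rewrite tnat_postwhisker; exact (left_iso_nat f).
Defined.

Definition biadjunction_of_universal_arrows : Biadjunction M G.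
Proof.
  refine (@Build_Biadjunction C B M G U ε left_modification _ right_modification _).
  - intros X; exact (iso_invertible (left_iso X)).
  - intros Y; exact (iso_invertible (counit_iso Y)).
Defined.
End BiadjunctionOfUniversalArrows.

Theorem left_biadjoint_of_universal_arrows (B C : Bicategory) (G : Pseudofunctor B C) (M : C -> B)
  (u : forall X : C, hom X (G (M X))) :
  (forall X : C, universal_arrow (u X)) ->
  exists Mp : Pseudofunctor C B, (forall X : C, Mp X = M X) /\ is_left_biadjoint Mp G.
Proof.
  intros u_universal.
  exists (lift_pseudofunctor (P := pseudofunctor_id C) u_universal); split; [reflexivity|].
  constructor.
  exact (biadjunction_of_universal_arrows
    (U := lift_transformation (P := pseudofunctor_id C) u_universal) u_universal).
Qed.

Theorem theorem3
  (A B C : Bicategory)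
  (F : Pseudofunctor A B) (G : Pseudofunctor B C) (H : Pseudofunctor A C)
  (Gamma : Transformation (pseudofunctor_comp G F) H)
  (Gamma_equiv : pseudonatural_equivalence Gamma)
  (L : Pseudofunctor B A) (L_F : is_left_biadjoint L F)
  (N : Pseudofunctor C A) (N_H : Biadjunction N H)
  (G_ff : fully_faithful G) :
  let HN : Pseudofunctor C C := pseudofunctor_comp H N in
  let Psi : Transformation (pseudofunctor_id C) HN := biadj_unit N_H in
  forall (mu' : Modification (unit_prewhisker Psi HN) (unit_postwhisker HN Psi))
    (M' : C -> C) (Lambda' : forall X : C, hom (M' X) (HN X))
    (Lambda'_inverter : forall X : C, is_inverter (mu' X) (Lambda' X))
    (mu'_Psi_inv : invertible_modification (modification_rwhisker mu' Psi))
    (ess_image_iff : forall X : C,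
       in_essential_image G X <-> is_inverter (mu' X) (Psi X))
    (Lambda'_pseudomonic : forall X : C, pseudomonic (HN ·₁ Lambda' X)),
  (forall X : C, in_essential_image G (M' X)) /\
  (forall M : C -> B, (forall X : C, equivalent (G (M X)) (M' X)) ->
     exists Mp : Pseudofunctor C B,
       (forall X : C, Mp X = M X) /\ is_left_biadjoint Mp G).
Proof.
  intros HN Psi mu' M' Lambda' Lambda'_inverter mu'_Psi_inv ess_image_iff Lambda'_pseudomonic.
  assert (unit : forall X, exists e : hom X (M' X), Lambda' X ∘ e ≅ Psi X)
    by exact (exists_reflection_unit Lambda'_inverter mu'_Psi_inv).
  split.
  - intros X; apply ess_image_iff; destruct (unit X) as [e He].
    exact (reflection_is_inverter Lambda'_inverter Lambda'_pseudomonic He).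
  - intros M HM.
    assert (u : forall X, {u : hom X (G (M X)) | universal_arrow u}).
    { intros X; apply constructive_indefinite_description.
      destruct (unit X) as [e He], (HM X) as [a [b [Hba Hab]]].
      (* [b] is the chosen equivalence from [M' X] to [G (M X)], so this is the reflection [e]
         carried over to the prescribed object. *)
      exists (b ∘ e); intros Y.
      refine (weak_equivalence_natiso (natiso_rwhisker (precomp_comp (G Y) b e) (ploc G (M X) Y)) _).
      apply weak_equivalence_comp; [|exact (equivalence_weak (G_ff (M X) Y))].
      apply weak_equivalence_comp.
      + apply (precomp_unit_inverter Lambda'_inverter Lambda'_pseudomonic He).
        (* [G Y] lies in the essential image, so the third hypothesis makes it an inverter, to which
           the extension property of [e] applies. *)
        apply ess_image_iff, in_essential_image_ob.
      + apply equivalence_precomp; exists a; split; assumption. }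
    exact (left_biadjoint_of_universal_arrows (fun X => proj2_sig (u X))).
Qed.
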